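(* Let $\Omega\subset\mathbb{R}^n$ be a nonempty open bounded convex set satisfying an interior sphere condition, such that $\overline\Sigma(\Omega)\ne\mathrm M(\Omega)$ and such that there exists an inner ball $B\subset\Omega$ of radius $\rho_\Omega$ whose boundary meets $\partial\Omega$ at two points lying on the same diameter of $B$. Further, assume that the unique solution $u$ to the Dirichlet problem $-\Delta_\infty u=1$ in $\Omega$, $u=0$ on $\partial\Omega$, is of class $C^1$ on $\{x\in\overline\Omega:\operatorname{dist}(x,\partial\Omega)<\delta\}$ for some $\delta>0$. Let $K$ be the set of points where $u$ attains its maximum over $\overline\Omega$. Then $u\notin C^{1,1}(\Omega\setminus K)$.
   Context: For smooth $\varphi$, $\Delta_\infty\varphi:=\langle\nabla^2\varphi\,\nabla\varphi,\nabla\varphi\rangle$. A solution to the Dirichlet problem is a function $u\in C(\overline\Omega)$ with $u=0$ on $\partial\Omega$ which is a viscosity solution of $-\Delta_\infty u=1$ in $\Omega$, i.e. for every $x_0\in\Omega$ and $\varphi\in C^2(\Omega)$: if $u-\varphi$ has a local maximum at $x_0$ then $-\Delta_\infty\varphi(x_0)-1\le 0$, and if $u-\varphi$ has a local minimum at $x_0$ then $-\Delta_\infty\varphi(x_0)-1\ge 0$. Interior sphere condition: every point of $\partial\Omega$ lies on the boundary of some open ball contained in $\Omega$. $d_{\partial\Omega}$ is the distance to $\partial\Omega$; $\rho_\Omega:=\max_{\overline\Omega}d_{\partial\Omega}$ is the inradius. $\Sigma(\Omega)$ is the set of points of $\Omega$ where $d_{\partial\Omega}$ is not differentiable; the cut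 locus $\overline\Sigma(\Omega)$ is the closure of $\Sigma(\Omega)$ in $\overline\Omega$; the high ridge is $\mathrm M(\Omega):=\{x\in\Omega:d_{\partial\Omega}(x)=\rho_\Omega\}$. $u\in C^{1,1}(\Omega\setminus K)$ means that $u$ is $C^1$ with locally Lipschitz gradient in $\Omega\setminus K$. *)

(* Defs.v *)
From HB Require Import structures.
From mathcomp Require Import all_boot all_order all_algebra.
From mathcomp Require Import all_classical all_reals all_analysis.

Set Implicit Arguments.
Unset Strict Implicit.
Unset Printing Implicit Defensive.

Import Order.TTheory GRing.Theory Num.Theory.
Import numFieldNormedType.Exports.

Local Open Scope classical_set_scope.
Local Open Scope ring_scope.

(* R^n is 'rV[R]_n. Its library norm `|x| is the
   sup norm; it generates the usual topology, so open, closure, continuous,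
   differentiable, bounded_set and lipschitz (up to the constant) are the usual
   notions, but every metric quantity below uses the Euclidean norm. *)

Definition dotv (R : realType) (n : nat) (v w : 'rV[R]_n) : R :=
  \sum_(i < n) v 0 i * w 0 i.

Definition enorm (R : realType) (n : nat) (v : 'rV[R]_n) : R :=
  Num.sqrt (dotv v v).

Definition eball (R : realType) (n : nat) (c : 'rV[R]_n) (r : R) :
    set 'rV[R]_n :=
  [set y | enorm (y - c) < r].

Definition boundary (T : topologicalType) (A : set T) : set T :=
  closure A `\` interior A.

(* Used only for nonempty A; for A = set0 it takes the default value 0. *)
Definition edist (R : realType) (n : nat) (A : set 'rV[R]_n) (x : 'rV[R]_n) :
    R :=
  inf [set enorm (x - y) | y in A].

Definition bdist (R : realType) (n : nat) (Omega : set 'rV[R]_n) :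
    'rV[R]_n -> R :=
  edist (boundary Omega).

Definition inradius (R : realType) (n : nat) (Omega : set 'rV[R]_n) : R :=
  sup [set bdist Omega x | x in closure Omega].

Definition singular_set (R : realType) (n : nat) (Omega : set 'rV[R]_n) :
    set 'rV[R]_n :=
  [set x | Omega x /\ ~ differentiable (bdist Omega) x].

(* As singular_set Omega is contained in Omega, its closure in R^n coincides
   with its closure relative to closure Omega. *)
Definition cut_locus (R : realType) (n : nat) (Omega : set 'rV[R]_n) :
    set 'rV[R]_n :=
  closure (singular_set Omega).

Definition high_ridge (R : realType) (n : nat) (Omega : set 'rV[R]_n) :
    set 'rV[R]_n :=
  [set x | Omega x /\ bdist Omega x = inradius Omega].

Definition interior_sphere (R : realType) (n : nat) (Omega : set 'rV[R]_n) :
    Prop :=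
  forall y, boundary Omega y ->
    exists c r, [/\ 0 < r, eball c r `<=` Omega & boundary (eball c r) y].

(* Two distinct points of a sphere lie on one diameter exactly when the centre
   is their midpoint. *)
Definition antipodal_inner_ball (R : realType) (n : nat)
    (Omega : set 'rV[R]_n) : Prop :=
  exists c : 'rV[R]_n, let B := eball c (inradius Omega) in
    B `<=` Omega /\
    exists p q : 'rV[R]_n,
      [/\ (boundary B `&` boundary Omega) p,
          (boundary B `&` boundary Omega) q,
          p != q & c = 2^-1 *: (p + q)].

Definition grad (R : realType) (n : nat) (f : 'rV[R]_n -> R) (x : 'rV[R]_n) :
    'rV[R]_n :=
  \row_i 'D_(delta_mx 0 i) f x.

(* With row vectors, the Hessian acts on v by v *m hess f x, the derivative of
   grad f at x in the direction v. *)
Definition hess (R : realType) (n : nat) (f : 'rV[R]_n -> R) (x : 'rV[R]_n) :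
    'M[R]_n :=
  'J (grad f) x.

Definition inf_laplacian (R : realType) (n : nat) (f : 'rV[R]_n -> R)
    (x : 'rV[R]_n) : R :=
  dotv (grad f x *m hess f x) (grad f x).

(* C1_on, C2_on and C11_on are meant for open sets A. *)
Definition C1_on (R : realType) (n : nat) (A : set 'rV[R]_n)
    (f : 'rV[R]_n -> R) : Prop :=
  forall x, A x -> differentiable f x /\ {for x, continuous (grad f)}.

Definition C2_on (R : realType) (n : nat) (A : set 'rV[R]_n)
    (f : 'rV[R]_n -> R) : Prop :=
  C1_on A f /\
  forall x, A x ->
    differentiable (grad f) x /\ {for x, continuous (hess f)}.

Definition C11_on (R : realType) (n : nat) (A : set 'rV[R]_n)
    (f : 'rV[R]_n -> R) : Prop :=
  C1_on A f /\
  forall x, A x ->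
    exists2 U, nbhs x U & [lipschitz (grad f y) | y in U].

(* C^1 up to the boundary, for a set A relatively open in the closure of the
   open set Omega: the gradient, defined on A `&` Omega, extends continuously
   to A. *)
Definition C1_upto_boundary (R : realType) (n : nat)
    (Omega A : set 'rV[R]_n) (f : 'rV[R]_n -> R) : Prop :=
  {within A, continuous f} /\
  exists2 g : 'rV[R]_n -> 'rV[R]_n,
    {within A, continuous g} &
    forall x, (A `&` Omega) x -> differentiable f x /\ grad f x = g x.

(* In the next two definitions x is interior to Omega, so the local maximum or
   minimum only involves values of u and phi in Omega. *)
Definition viscosity_subsolution (R : realType) (n : nat)
    (Omega : set 'rV[R]_n) (u : 'rV[R]_n -> R) : Prop :=
  forall (x : 'rV[R]_n) (phi : 'rV[R]_n -> R), Omega x -> C2_on Omega phi ->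
    (\forall y \near x, u y - phi y <= u x - phi x) ->
    - inf_laplacian phi x - 1 <= 0.

Definition viscosity_supersolution (R : realType) (n : nat)
    (Omega : set 'rV[R]_n) (u : 'rV[R]_n -> R) : Prop :=
  forall (x : 'rV[R]_n) (phi : 'rV[R]_n -> R), Omega x -> C2_on Omega phi ->
    (\forall y \near x, u x - phi x <= u y - phi y) ->
    0 <= - inf_laplacian phi x - 1.

(* Only the values of u on closure Omega are relevant. *)
Definition dirichlet_solution (R : realType) (n : nat)
    (Omega : set 'rV[R]_n) (u : 'rV[R]_n -> R) : Prop :=
  [/\ {within closure Omega, continuous u},
      forall x, boundary Omega x -> u x = 0,
      viscosity_subsolution Omega u &
      viscosity_supersolution Omega u].

Definition argmax_set (R : realType) (n : nat) (Omega : set 'rV[R]_n)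
    (u : 'rV[R]_n -> R) : set 'rV[R]_n :=
  [set x | closure Omega x /\ forall y, closure Omega y -> u y <= u x].

(* Main.v *)
(* Write m = max u, K = argmax u, d = bdist Omega, P = |grad u|^4 / 4 + u, and
   D = ((4 m)^(3/4) - (4 (m - u))^(3/4)) / 3, so that |grad D| >= 1 wherever
   P >= m. If u is C^{1,1} off K, then D = d there, which forces the cut locus
   and the high ridge to coincide with K.
   - D <= d holds for every subsolution, by comparison with the one-dimensional
     profiles centred at boundary points, for which D is the distance.
   - P >= m off K: the lower quadratic bound given by C^{1,1} makes x the minimum
     of u over the ball of small radius r centred at y = x + r grad u / |grad u|.
     Comparison in that ball with radial strict subsolutions bounds
     |grad u (x)| - |grad u (y)| from below, so P - eta u decreases from x to y
     while u increases. Hence P - eta u restricted to a band of values of u is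
     smallest at the top level, where P >= u is almost m. There is no critical
     point off K, since u would be touched from below there by - C |h|^2.
   - |grad D| >= 1 off K gives D >= d: for k < 1, D + k |. - x| has no minimum off
     K inside Omega. *)
Require Import Defs.
From mathcomp Require Import all_boot all_order all_algebra.
From mathcomp Require Import all_classical all_reals all_analysis.
From mathcomp Require Import ring lra.

Import Order.TTheory GRing.Theory Num.Theory.
Import numFieldNormedType.Exports.

Local Open Scope classical_set_scope.
Local Open Scope ring_scope.

Set Implicit Arguments.
Unset Strict Implicit.

(** * Euclidean inner product and norm on row vectors *)

Section Euclidean.
Context {R : realType} {n : nat}.
Implicit Types (u v w x y p : 'rV[R]_n).

Lemma dotvC v w : dotv v w = dotv w v.
Proof. by apply: eq_bigr => i _; rewrite mulrC. Qed.

Lemma dotvDl u v w : dotv (u + v) w = dotv u w + dotv v w.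
Proof. by rewrite /dotv -big_split; apply: eq_bigr => i _; rewrite mxE mulrDl. Qed.

Lemma dotvZl c v w : dotv (c *: v) w = c * dotv v w.
Proof. by rewrite /dotv mulr_sumr; apply: eq_bigr => i _; rewrite mxE mulrA. Qed.

Lemma dotvDr u v w : dotv u (v + w) = dotv u v + dotv u w.
Proof. by rewrite dotvC dotvDl !(dotvC u). Qed.

Lemma dotvZr c v w : dotv v (c *: w) = c * dotv v w.
Proof. by rewrite dotvC dotvZl dotvC. Qed.

Lemma dotvNl v w : dotv (- v) w = - dotv v w.
Proof. by rewrite -scaleN1r dotvZl mulN1r. Qed.

Lemma dotvNr v w : dotv v (- w) = - dotv v w.
Proof. by rewrite dotvC dotvNl dotvC. Qed.

Lemma dotv0l w : dotv 0 w = 0.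
Proof. by rewrite -(scale0r w) dotvZl mul0r. Qed.

Lemma dotv_ge0 v : 0 <= dotv v v.
Proof. by apply: sumr_ge0 => i _; rewrite -expr2 sqr_ge0. Qed.

Lemma enorm_ge0 v : 0 <= enorm v.
Proof. exact: sqrtr_ge0. Qed.

Lemma sqr_enorm v : enorm v ^+ 2 = dotv v v.
Proof. by rewrite sqr_sqrtr // dotv_ge0. Qed.

Lemma enormZ c v : enorm (c *: v) = `|c| * enorm v.
Proof. by rewrite /enorm dotvZl dotvZr mulrA -expr2 sqrtrM ?sqr_ge0 // sqrtr_sqr. Qed.

Lemma enorm0 : enorm (0 : 'rV[R]_n) = 0.
Proof. by rewrite -(scale0r 0) enormZ normr0 mul0r. Qed.

Lemma enormN v : enorm (- v) = enorm v.
Proof. by rewrite -scaleN1r enormZ normrN1 mul1r. Qed.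

Lemma enorm_distC v w : enorm (v - w) = enorm (w - v).
Proof. by rewrite -enormN opprB. Qed.

Lemma normr_le_enorm v : `|v| <= enorm v.
Proof.
rewrite /Num.Def.normr/= mx_normrE; apply: bigmax_le; first exact: enorm_ge0.
move=> [i j] _ /=; rewrite -sqrtr_sqr ler_wsqrtr // (ord1 i) /dotv (bigD1 j) //=.
by rewrite -expr2 lerDl sumr_ge0 // => k _; rewrite -expr2 sqr_ge0.
Qed.

Lemma enorm_eq0 v : enorm v = 0 -> v = 0.
Proof.
by move=> v0; apply/eqP; rewrite -normr_le0 (le_trans (normr_le_enorm v)) // v0.
Qed.

Lemma enorm_gt0 v : v != 0 -> 0 < enorm v.
Proof.
move=> v0; rewrite lt_neqAle enorm_ge0 andbT eq_sym.
by apply: contra v0 => /eqP /enorm_eq0 ->.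
Qed.

Lemma cauchy_schwarz v w : dotv v w <= enorm v * enorm w.
Proof.
have [->|v0] := eqVneq v 0; first by rewrite dotv0l enorm0 mul0r.
have [->|w0] := eqVneq w 0; first by rewrite dotvC dotv0l enorm0 mulr0.
have /enorm_gt0 a0 := v0; have /enorm_gt0 b0 := w0.
have := dotv_ge0 (enorm w *: v - enorm v *: w).
rewrite !(dotvDl, dotvDr, dotvNl, dotvNr, dotvZl, dotvZr) (dotvC w v) -!sqr_enorm.
set a := enorm v in a0 *; set b := enorm w in b0 *; set d := dotv v w.
move=> H; have : 0 <= (a * b) * (a * b - d) by nra.
by rewrite pmulr_rge0 ?mulr_gt0 // subr_ge0.
Qed.

Lemma ler_enormD v w : enorm (v + w) <= enorm v + enorm w.
Proof.
rewrite -(@ler_pXn2r _ 2) ?nnegrE ?addr_ge0 ?enorm_ge0 //.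
rewrite sqr_enorm !(dotvDl, dotvDr) (dotvC w v) sqrrD -!sqr_enorm.
by have := cauchy_schwarz v w; lra.
Qed.

Lemma ler_enorm_dist u v w : enorm (u - w) <= enorm (u - v) + enorm (v - w).
Proof. by rewrite -(subrKA v u (- w)) ler_enormD. Qed.

Lemma lerB_enorm v w : `|enorm v - enorm w| <= enorm (v - w).
Proof.
rewrite ler_norml; have := ler_enormD (v - w) w; have := ler_enormD (w - v) v.
by rewrite !subrK (enorm_distC w); lra.
Qed.

Lemma enorm_le_normr v : enorm v <= Num.sqrt n%:R * `|v|.
Proof.
have -> : `|v| = Num.sqrt (`|v| ^+ 2) by rewrite sqrtr_sqr normr_id.
rewrite -sqrtrM ?ler0n // ler_wsqrtr // mulr_natl.
rewrite -[X in _ *+ X]card_ord -sumr_const; apply: ler_sum => i _.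
have : `|v 0 i| <= `|v|.
  rewrite [leRHS]/Num.Def.normr/= mx_normrE.
  exact: (le_bigmax _ (fun ij : 'I_1 * 'I_n => `|v ij.1 ij.2|) (0, i)).
by move=> h; rewrite -expr2 -real_normK ?num_real // lerXn2r ?nnegrE.
Qed.

Lemma near_enormP x (P : set 'rV[R]_n) :
  (\forall y \near x, P y) <->
  exists2 e, 0 < e & forall y, enorm (y - x) < e -> P y.
Proof.
split=> [/nbhs_normP[e /= e0 eP]|[e e0 eP]].
  exists e => // y ye; apply: eP => /=.
  by rewrite distrC (le_lt_trans (normr_le_enorm _)).
(* The summand 1 keeps [k] positive even when [n = 0]. *)
pose k := Num.sqrt n%:R + 1 : R.
have k0 : 0 < k by rewrite ltr_wpDl ?sqrtr_ge0.
apply/nbhs_normP; exists (e / k) => /=; first by rewrite divr_gt0.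
move=> y /=; rewrite distrC ltr_pdivlMr // => ye; apply: eP.
apply: le_lt_trans (enorm_le_normr _) (le_lt_trans _ ye).
by rewrite mulrC ler_wpM2l // lerDl.
Qed.

Lemma enorm_continuous : continuous (@enorm R n).
Proof.
move=> x; apply: (pseudometric_normed_Zmodule.cvgrPdist_lt
  (FF := nbhs_filter x) _ _).2 => e e0.
apply/near_enormP; exists e => // y ye.
by rewrite (le_lt_trans (lerB_enorm _ _)) // enorm_distC.
Qed.

(** * Differentiation rules and quadratic test functions *)

Lemma derive_expansion (W : normedModType R) (f : 'rV[R]_n -> W) x v (l c : W) :
  (forall h : R, f (h *: v + x) = f x + h *: l + h ^+ 2 *: c) -> 'D_v f x = l.
Proof.
move=> fE; apply/cvg_lim => //.
apply: (@cvg_trans _ ((l + h *: c) @[h --> 0^'])).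
  apply: near_eq_cvg; near=> h.
  rewrite /= fE -[f x + _ + _]addrA [f x + _]addrC addrK scalerDr !scalerA expr2 mulrA.
  by rewrite mulVf ?mul1r ?scale1r //; near: h; exact: nbhs_dnbhs_neq.
have -> : l = l + 0 *: c by rewrite scale0r addr0.
rewrite [in X in X `=>` _]scale0r addr0; apply: cvgD; first exact: cvg_cst.
by apply: cvgZr_tmp; apply: cvg_within.
Unshelve. all: by end_near. Qed.

Lemma differentiable_dotv (V : normedModType R) (f g : V -> 'rV[R]_n) z :
  differentiable f z -> differentiable g z ->
  differentiable (fun a => dotv (f a) (g a)) z.
Proof.
move=> df dg.
have -> : (fun a => dotv (f a) (g a)) =
    \sum_(i < n) ((fun a => f a 0 i) * (fun a => g a 0 i)).
  by apply/funext => y; rewrite fct_sumE.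
apply: differentiable_sum => i; apply: differentiableM;
  by apply: (@differentiable_comp _ _ _ _ _ (fun M : 'rV[R]_n => M 0 i));
  [|exact: differentiable_coord].
Qed.

Lemma differentiable_mulmx (S : 'M[R]_n) x : differentiable (mulmx^~ S) x.
Proof.
have -> : mulmx^~ S = \sum_(i < n) (fun y : 'rV[R]_n => y 0 i *: row i S).
  by apply/funext => y; rewrite fct_sumE mulmx_sum_row.
apply: differentiable_sum => i; apply: differentiableZl.
exact: differentiable_coord.
Qed.

Lemma derive_grad (f : 'rV[R]_n -> R) x v :
  differentiable f x -> 'D_v f x = dotv (grad f x) v.
Proof.
move=> df; rewrite deriveE // [in LHS](row_sum_delta v) linear_sum.
apply: eq_bigr => i _; rewrite linearZ /= mxE deriveE //.
by rewrite mulrC.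
Qed.

Section quadratic.
Variables (p z : 'rV[R]_n) (S : 'M[R]_n).
Hypothesis symS : S^T = S.

(** Prescribed second-order data at [z]: value 0, gradient [p], and Hessian [S] once [S] is
    symmetric. Being polynomial, it is admissible as a viscosity test function on any [Omega]. *)
Definition quadf x := dotv p (x - z) + 2^-1 * dotv ((x - z) *m S) (x - z).

Lemma dotv_mulmx_sym v w : dotv (v *m S) w = dotv (w *m S) v.
Proof.
have dotE a b : dotv a b = (a *m b^T) 0 0.
  by rewrite mxE; apply: eq_bigr => i _; rewrite mxE.
by rewrite dotvC !dotE trmx_mul symS mulmxA.
Qed.

Lemma differentiable_sub x : differentiable (fun y => y - z) x.
Proof. exact: differentiableB. Qed.

Lemma differentiable_affine x : differentiable (fun y => p + (y - z) *m S) x.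
Proof.
apply: differentiableD; first exact: differentiable_cst.
exact: (differentiable_comp (differentiable_sub x) (differentiable_mulmx S _)).
Qed.

Lemma differentiable_quadf x : differentiable quadf x.
Proof.
apply: differentiableD.
  by apply: differentiable_dotv; [exact: differentiable_cst|exact: differentiable_sub].
apply: differentiableM; first exact: differentiable_cst.
apply: differentiable_dotv; last exact: differentiable_sub.
exact: (differentiable_comp (differentiable_sub x) (differentiable_mulmx S _)).
Qed.

Lemma grad_quadf : grad quadf = fun y => p + (y - z) *m S.
Proof.
apply/funext => x; apply/rowP => i; rewrite mxE.
have -> : (p + (x - z) *m S) 0 i = dotv (p + (x - z) *m S) (delta_mx 0 i).
  rewrite /dotv (bigD1 i) //= big1 => [|j ji]; rewrite !mxE !eqxx ?mulr1 ?addr0 //=.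
  by rewrite (negPf ji) mulr0.
(* Along a line [quadf] is a polynomial of degree two, so its derivative is the linear coefficient
   and no limit has to be computed. *)
apply: (@derive_expansion _ _ _ _ _
  (2^-1 * dotv (delta_mx 0 i *m S) (delta_mx 0 i))) => h.
rewrite /quadf -(addrA (h *: _)); move: (delta_mx 0 i) (x - z) => d w.
rewrite mulmxDl -scalemxAl !(dotvDl, dotvDr, dotvZl, dotvZr).
by rewrite (dotv_mulmx_sym d w) -![_ *: (_ : R^o)]/(_ * _) [X in _ = X]/=; field.
Qed.

Lemma hess_quadf x : hess quadf x = S.
Proof.
rewrite /hess grad_quadf; apply/row_matrixP => i; rewrite !rowE.
rewrite -deriveEjacobian; last exact: differentiable_affine.
apply: (@derive_expansion _ _ _ _ _ 0) => h.
by rewrite scaler0 addr0 -addrA mulmxDl -scalemxAl addrA addrAC.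
Qed.

Lemma C2_quadf (A : set 'rV[R]_n) : C2_on A quadf.
Proof.
split=> x _.
  split; first exact: differentiable_quadf.
  by rewrite grad_quadf; exact/differentiable_continuous/differentiable_affine.
rewrite [in X in X /\ _]grad_quadf; split; first exact: differentiable_affine.
have -> : hess quadf = cst S by apply/funext => y; exact: hess_quadf.
exact: cst_continuous.
Qed.

Lemma inf_laplacian_quadf : inf_laplacian quadf z = dotv (p *m S) p.
Proof. by rewrite /inf_laplacian hess_quadf grad_quadf subrr mul0mx addr0. Qed.

Lemma quadf0 : quadf z = 0.
Proof. by rewrite /quadf subrr mul0mx dotvC !dotv0l mulr0 addr0. Qed.

End quadratic.
End Euclidean.

(** * Viscosity inequalities tested with ridge-shaped and radial profiles *)

Section ViscosityTests.
Context {R : realType} {n : nat}.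
Implicit Types (x y z h e : 'rV[R]_n) (A B C : R) (u : 'rV[R]_n -> R).
Implicit Types Omega : set 'rV[R]_n.

Lemma mulmx_outer h e : h *m (e^T *m e) = dotv h e *: e.
Proof.
rewrite mulmxA; apply/rowP => j; rewrite !mxE big_ord1; congr (_ * _).
by rewrite mxE; apply: eq_bigr => i _; rewrite mxE.
Qed.

(* The curvature 2 C across e does not enter the infinity Laplacian, so it is
   free to absorb the curvature of spheres. *)
Definition ridge_model A B C e h : R :=
  A * dotv e h + 2^-1 * B * dotv e h ^+ 2 + C * (dotv h h - dotv e h ^+ 2).

Lemma ridge_modelP Omega A B C e z : enorm e = 1 ->
  exists phi, [/\ C2_on Omega phi, inf_laplacian phi z = A ^+ 2 * B,
    phi z = 0 & forall x, phi x = ridge_model A B C e (x - z)].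
Proof.
(* [S] has eigenvalue [B] on [e] and [2 * C] on the orthogonal complement of [e]; the gradient
   [A *: e] at [z] sees only the former. *)
move=> e1; pose S := (B - 2 * C) *: (e^T *m e) + (2 * C)%:M.
have mulS h : h *m S = ((B - 2 * C) * dotv h e) *: e + (2 * C) *: h.
  by rewrite mulmxDr -scalemxAr mulmx_outer mul_mx_scalar scalerA.
have symS : S^T = S.
  by rewrite linearD linearZ /= trmx_mul trmxK tr_scalar_mx.
exists (quadf (A *: e) z S); split.
- exact: C2_quadf.
- rewrite inf_laplacian_quadf // mulS !(dotvDl, dotvDr, dotvZl, dotvZr).
  by rewrite -sqr_enorm e1; ring.
- exact: quadf0.
- move=> x; rewrite /quadf /ridge_model mulS.
  rewrite !(dotvDl (_ *: e), dotvZl) (dotvC (x - z) e).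
  by move: (dotv e _) (dotv (x - z) _) => a b; field.
Qed.

Lemma subsolution_ridge Omega u A B C e z :
  viscosity_subsolution Omega u -> Omega z -> enorm e = 1 ->
  (\forall x \near z, u x <= u z + ridge_model A B C e (x - z)) ->
  - (A ^+ 2 * B) <= 1.
Proof.
move=> sub Oz e1 ule.
have [phi [C2 lap phiz phiE]] := ridge_modelP Omega A B C z e1.
have := sub z phi Oz C2; rewrite lap phiz subr0 subr_le0; apply.
by apply: filterS ule => x; rewrite phiE lerBlDr.
Qed.

Lemma supersolution_ridge Omega u A B C e z :
  viscosity_supersolution Omega u -> Omega z -> enorm e = 1 ->
  (\forall x \near z, u z + ridge_model A B C e (x - z) <= u x) ->
  1 <= - (A ^+ 2 * B).
Proof.
move=> sup Oz e1 ule.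
have [phi [C2 lap phiz phiE]] := ridge_modelP Omega A B C z e1.
have := sup z phi Oz C2; rewrite lap phiz subr0 subr_ge0; apply.
by apply: filterS ule => x; rewrite phiE lerBrDr.
Qed.

Lemma enorm_unit_split s e h : enorm e = 1 -> 0 < s ->
  enorm h <= s / 2 ->
  let t := dotv e h in let d := enorm (h + s *: e) - s in
  [/\ `|t| <= s / 2, `|d| <= s / 2 &
      0 <= d - t <= (dotv h h - t ^+ 2) / s].
Proof.
move=> e1 s0 hs t d.
have nt : `|t| <= enorm h.
  have := cauchy_schwarz e h; have := cauchy_schwarz e (- h).
  by rewrite enormN dotvNr e1 mul1r ler_norml -/t; lra.
have nse : enorm (s *: e) = s by rewrite enormZ e1 mulr1 gtr0_norm.
have nd : `|d| <= enorm h.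
  by have := lerB_enorm (h + s *: e) (s *: e); rewrite nse addrK.
split; [exact: le_trans hs|exact: le_trans hs|].
have q0 := enorm_ge0 (h + s *: e).
have := sqr_enorm (h + s *: e).
rewrite !(dotvDl, dotvDr, dotvZl, dotvZr) -(sqr_enorm e) e1 (dotvC h e) -/t.
rewrite -/(enorm _) /d.
have : 0 <= dotv h h - t ^+ 2.
  rewrite -sqr_enorm subr_ge0 -(real_normK (num_real t)).
  by rewrite lerXn2r ?nnegrE ?enorm_ge0.
move: (le_trans nt hs); rewrite ler_norml => /andP[t1 t2].
set q := enorm (h + _) in q0 *; set hh := dotv h h => w0 qE.
have ge : s + t <= q.
  by rewrite leNgt; apply/negP => lt; nra.
apply/andP; split; first lra.
by rewrite ler_pdivlMr //; nra.
Qed.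

Section radial.
Variables (Omega : set 'rV[R]_n) (u : 'rV[R]_n -> R).
Variables (A B : R) (y z : 'rV[R]_n).
Hypotheses (Oz : Omega z) (yz : z != y).

Definition radial_model x : R :=
  let d := enorm (x - y) - enorm (z - y) in A * d + 2^-1 * B * d ^+ 2.

(** To first order the distance to [y] varies along the unit vector [e] from [y] to [z]; the error
    is quadratic in the displacement across [e], exactly what the free coefficient [C] of a ridge
    absorbs. *)
Lemma radial_ridge : exists e C, enorm e = 1 /\
  \forall x \near z, `|radial_model x - ridge_model A B 0 e (x - z)| <=
    ridge_model 0 0 C e (x - z).
Proof.
set s := enorm (z - y).
have s0 : 0 < s by rewrite enorm_gt0 // subr_eq0.
pose e := s^-1 *: (z - y).
have e1 : enorm e = 1 by rewrite enormZ gtr0_norm ?invr_gt0 // mulVf ?gt_eqF.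
have see : s *: e = z - y by rewrite scalerA mulfV ?gt_eqF // scale1r.
(* The error factors as (d - t) (A + B (d + t) / 2), where d - t is at most (|h|^2 - t^2) / s and |d
   + t| is at most s. *)
exists e, ((`|A| + 2^-1 * `|B| * s) / s); split=> //.
apply/near_enormP; exists (s / 2); first by rewrite divr_gt0.
move=> x /ltW xs; have [tb db /andP[dt0 dt1]] := enorm_unit_split e1 s0 xs.
rewrite /radial_model /ridge_model !(mul0r, mulr0) !add0r addr0.
rewrite see subrKA -/s in db dt0 dt1 *.
move: (enorm (x - y) - s) (dotv e _) (dotv (x - z) _) db dt0 dt1 tb => d t hh.
move=> db dt0 dt1 tb.
have -> : A * d + 2^-1 * B * d ^+ 2 - (A * t + 2^-1 * B * t ^+ 2) =
  (d - t) * (A + 2^-1 * B * (d + t)) by ring.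
rewrite normrM ger0_norm //.
have -> : (`|A| + 2^-1 * `|B| * s) / s * (hh - t ^+ 2) =
  (hh - t ^+ 2) / s * (`|A| + 2^-1 * `|B| * s) by ring.
apply: ler_pM => //; apply: le_trans (ler_normD _ _) _.
rewrite lerD2l !normrM ger0_norm ?invr_ge0 // ler_pM ?mulr_ge0 ?invr_ge0 //.
by apply: le_trans (ler_normD _ _) _; lra.
Qed.

(** A radial profile can be singular at [y], which may lie in [Omega], so it is replaced by a
    quadratic that lies above it near [z] and has the same slope and curvature along [e]. The
    supersolution version uses [- C] to stay below. *)
Lemma subsolution_radial : viscosity_subsolution Omega u ->
  (\forall x \near z, u x <= u z + radial_model x) -> - (A ^+ 2 * B) <= 1.
Proof.
move=> sub ule; have [e [C [e1 near]]] := radial_ridge.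
apply: (@subsolution_ridge Omega u A B C e z) => //.
apply: filterS2 ule near => x; rewrite /ridge_model ler_norml.
by move=> ? /andP[_]; lra.
Qed.

Lemma supersolution_radial : viscosity_supersolution Omega u ->
  (\forall x \near z, u z + radial_model x <= u x) -> 1 <= - (A ^+ 2 * B).
Proof.
move=> sup ule; have [e [C [e1 near]]] := radial_ridge.
apply: (@supersolution_ridge Omega u A B (- C) e z) => //.
apply: filterS2 ule near => x; rewrite /ridge_model ler_norml.
by move=> ? /andP[+ _]; lra.
Qed.

End radial.
End ViscosityTests.

(** * Slopes along rays and the lower quadratic bound of a C^{1,1} function *)

Section Rays.
Context {R : realType} {n : nat}.
Implicit Types (x y z h v : 'rV[R]_n) (f u : 'rV[R]_n -> R).

Lemma ray_expansion f x v e : differentiable f x -> 0 < e ->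
  exists2 d, 0 < d & forall t, 0 < t < d ->
    `|f (x + t *: v) - f x - t * dotv (grad f x) v| <= e * t.
Proof.
move=> df e0; have := @diff_derivable _ _ _ f x v df.
rewrite /derivable -/('D_v f x) => /cvg_ex[l lP].
have := cvg_lim (@norm_hausdorff _ _) lP; rewrite -/('D_v f x) derive_grad // => lE.
have /pseudometric_normed_Zmodule.cvgrPdist_lt/(_ e e0)/nbhs_normP[d /= d0 dP] := lP.
exists d => // t /andP[t0 td].
have := dP t; rewrite /= sub0r normrN gtr0_norm // => /(_ td).
rewrite gt_eqF // => /(_ isT)/ltW; rewrite -lE [t *: v + x]addrC.
set a := f _; set b := f x; rewrite -[_ *: (_ : R)]/(_ * _) => le.
have -> : a - b - t * dotv (grad f x) v =
  - ((dotv (grad f x) v - t^-1 * (a - b)) * t) by field; rewrite gt_eqF.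
by rewrite normrN normrM (gtr0_norm t0) ler_pM2r.
Qed.

Lemma ray_ge f x v c k : differentiable f x ->
  (exists2 d, 0 < d & forall t, 0 < t < d ->
    c * t - k * t ^+ 2 <= f (x + t *: v) - f x) ->
  c <= dotv (grad f x) v.
Proof.
move=> df [d d0 le]; apply/ler_addgt0Pr => e e0.
have e20 : 0 < e / 2 by rewrite divr_gt0.
have [d' d'0 exp] := ray_expansion v df e20.
(* For t below the last bound, k t^2 is at most (e / 2) t; together with the error of the expansion
   this makes e t. *)
pose m := Num.min (Num.min d d') (e / 2 / (`|k| + 1)).
have k0 : 0 < `|k| + 1 by rewrite ltr_wpDl.
have m0 : 0 < m by rewrite !lt_min d0 d'0 divr_gt0.
pose t := m / 2.
have t0 : 0 < t by rewrite divr_gt0.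
have tm : t < m by rewrite /t; lra.
have := tm; rewrite /m !lt_min => /andP[/andP[td td']].
rewrite ltr_pdivlMr // => tk.
have := le t; rewrite t0 td => /(_ isT).
have := exp t; rewrite t0 td' => /(_ isT).
rewrite ler_norml => /andP[_].
move: (f (x + t *: v) - f x) (dotv _ _) => a D le1 le2.
have kt : k * t ^+ 2 <= e / 2 * t.
  rewrite expr2 mulrA ler_pM2r // (le_trans _ (ltW tk)) // mulrC ler_pM2l //.
  by rewrite (le_trans (ler_norm _)) // lerDl.
by rewrite -(ler_pM2r t0); nra.
Qed.

Lemma ray_le f x v c k : differentiable f x ->
  (exists2 d, 0 < d & forall t, 0 < t < d ->
    f (x + t *: v) - f x <= c * t + k * t ^+ 2) ->
  dotv (grad f x) v <= c.
Proof.
move=> df [d d0 le].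
have dNf : differentiable (- f) x by exact: differentiableN.
have gN : grad (- f) x = - grad f x.
  by apply/rowP => i; rewrite !mxE deriveN //; exact: diff_derivable.
have := @ray_ge (- f) x v (- c) k dNf; rewrite gN dotvNl lerN2; apply.
by exists d => // t td; have := le t td; rewrite /= !fctE; lra.
Qed.

(** By the mean value theorem on the segment from [x] to [x + h], the increment is the gradient at
    an intermediate point applied to [h]; the Lipschitz bound compares that gradient with the one at
    [x]. *)
Lemma C11_lower_quadratic (A : set 'rV[R]_n) u x : open A -> C11_on A u -> A x ->
  exists C d, [/\ 0 < C, 0 < d & forall h, enorm h < d ->
    u x + dotv (grad u x) h - C * dotv h h <= u (x + h)].
Proof.
move=> oA [C1 lip] Ax; have [U Ux [M [_ HM]]] := lip x Ax.
have Ax' : nbhs x A by exact: open_nbhs_nbhs.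
have [d d0 dP] := (near_enormP x _).1 (filterI Ux Ax').
pose k := `|M| + 1; have k0 : 0 < k by rewrite ltr_wpDl.
have Mk : M < k by rewrite (le_lt_trans (ler_norm _)) // ltrDl.
have lipk := HM k Mk.
(* The factor sqrt n converts the sup-norm Lipschitz constant to the Euclidean norm; the summand 1
   makes the constant positive for every [n]. *)
exists (Num.sqrt n%:R * k + 1), d; split => //.
  by rewrite ltr_wpDl // mulr_ge0 ?sqrtr_ge0 // ltW.
move=> h hd.
have seg (t : R) : 0 <= t <= 1 -> (U `&` A) (t *: h + x).
  move=> /andP[t0 t1]; apply: dP; rewrite addrK enormZ ger0_norm //.
  by apply: le_lt_trans hd; rewrite -[leRHS]mul1r ler_wpM2r // enorm_ge0.
pose phi t := u (t *: h + x).
have dphi (t : R) : 0 <= t <= 1 -> is_derive t 1 phi (dotv (grad u (t *: h + x)) h).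
  move=> /seg[_ /C1[du _]].
  have E : (fun s => s^-1 *: ((phi \o shift t) (s *: 1) - phi t)) =
      (fun s => s^-1 *: ((u \o shift (t *: h + x)) (s *: h) - u (t *: h + x))).
    apply/funext => s; rewrite /phi /= addrA -scalerDl.
    by rewrite [s *: (1 : R)]mulr1.
  apply: DeriveDef; first by rewrite /derivable E; exact: diff_derivable.
  by rewrite /derive E; exact: derive_grad.
have [||c] := @MVT R phi (fun t => dotv (grad u (t *: h + x)) h) 0 1 ltr01.
- by move=> t; rewrite in_itv /= => /andP[t0 t1]; apply: dphi; rewrite !ltW.
- apply: derivable_within_continuous => t; rewrite in_itv /= => t01.
  by have /dphi[] := t01.
rewrite in_itv /= => /andP[c0 c1].
rewrite /phi scale1r scale0r add0r subr0 mulr1 [h + x]addrC => E.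
have [Uc _] : (U `&` A) (c *: h + x) by apply: seg; rewrite !ltW.
have [Ux0 _] : (U `&` A) (0 *: h + x) by apply: seg; rewrite lexx ler01.
rewrite scale0r add0r in Ux0.
have /= := lipk (x, c *: h + x) (conj Ux0 Uc).
rewrite opprD addrCA subrr addr0 normrN normrZ gtr0_norm // => ler.
have := cauchy_schwarz (grad u x - grad u (c *: h + x)) h.
rewrite dotvDl dotvNl -E => cs.
have := enorm_le_normr (grad u x - grad u (c *: h + x)).
have := normr_le_enorm h; rewrite -sqr_enorm.
have := enorm_ge0 h; have := sqrtr_ge0 (n%:R : R); have := normr_ge0 h.
move: cs ler; set a := enorm (_ - _); set b := enorm h; set N := `|_ - _|.
set s := Num.sqrt _; set H := `|h| => cs ler H0 s0 b0 hb aN.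
have N1 : N <= k * b.
  rewrite (le_trans ler) // ler_pM2l // (le_trans _ hb) //.
  by rewrite ler_piMl // ltW.
have : a <= s * k * b.
  by rewrite (le_trans aN) // -mulrA ler_wpM2l.
move=> ab; have : a * b <= (s * k * b) * b by rewrite ler_wpM2r.
have := sqr_ge0 b; nra.
Qed.

End Rays.

(** * Compactness, positivity of supersolutions and comparison in balls *)

Section Comparison.
Context {R : realType} {n : nat}.
Variables (Omega : set 'rV[R]_n) (u : 'rV[R]_n -> R).
Implicit Types (x y z h v : 'rV[R]_n).
Hypothesis oO : open Omega.
Hypothesis bO : bounded_set Omega.
Hypothesis cu : {within closure Omega, continuous u}.

Lemma closed_within_preimage (A : set 'rV[R]_n) (f : 'rV[R]_n -> R) (B : set R) :
  closed A -> {within A, continuous f} -> closed B -> closed (A `&` f @^-1` B).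
Proof.
move=> cA cf cB; rewrite (@closed_setSI _ A (f @^-1` B)) //.
by apply: (@preimage_closed (subspace A)) => // x; exact: cf.
Qed.

Lemma boundary_open x : boundary Omega x <-> closure Omega x /\ ~ Omega x.
Proof. by rewrite /boundary (proj1 (interior_id Omega)). Qed.

Lemma compact_closure_bounded : compact (closure Omega).
Proof.
apply: bounded_closed_compact; last exact: closed_closure.
have [M [Mr MP]] := bO; exists M; split=> // k Mk.
have cl : closed [set x : 'rV[R]_n | `|x| <= k].
  apply: (@preimage_closed _ _ (fun x : 'rV[R]_n => `|x|) [set t | t <= k]).
    by move=> x _; exact: norm_continuous.
  exact: closed_le.
by move=> x /(closureS (MP k Mk)); rewrite -(proj1 (closure_id _) cl).
Qed.

Lemma continuous_enorm_sub y : continuous (fun x : 'rV[R]_n => enorm (x - y)).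
Proof.
move=> x; apply: continuous_comp; last exact: enorm_continuous.
by apply: continuousB => //; exact: cst_continuous.
Qed.

Lemma compact_ball y r : compact [set x : 'rV[R]_n | enorm (x - y) <= r].
Proof.
apply: bounded_closed_compact.
  exists (r + `|y|); split; first by rewrite num_real.
  move=> k rk x /= xr; rewrite (le_trans _ (ltW rk)) // -[x](subrK y).
  by rewrite (le_trans (ler_normD _ _)) // lerD2r (le_trans (normr_le_enorm _)).
apply: (@preimage_closed _ _ (fun x : 'rV[R]_n => enorm (x - y)) [set t | t <= r]).
  by move=> x _; exact: continuous_enorm_sub.
exact: closed_le.
Qed.

Lemma within_comp (A : set 'rV[R]_n) (f : 'rV[R]_n -> R) (g : R -> R) :
  {within A, continuous f} -> continuous g ->
  {within A, continuous (fun x => g (f x))}.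
Proof. by move=> cf cg x; apply: continuous_comp; [exact: cf|exact: cg]. Qed.

Lemma within_add (A : set 'rV[R]_n) (f g : 'rV[R]_n -> R) :
  {within A, continuous f} -> {within A, continuous g} ->
  {within A, continuous (fun x => f x + g x)}.
Proof. by move=> cf cg x; apply: continuousD; [exact: cf|exact: cg]. Qed.

Lemma near_open z : Omega z -> \forall x \near z, Omega x.
Proof. by move=> Oz; exact: open_nbhs_nbhs. Qed.

Lemma continuous_interior z : Omega z -> {for z, continuous u}.
Proof.
move=> Oz; have := continuous_subspaceW (@subset_closure _ Omega) cu.
by rewrite continuous_open_subspace // => /(_ z); apply; rewrite inE.
Qed.

Hypothesis super : viscosity_supersolution Omega u.

(** The paraboloid has zero gradient at [z], so its infinity Laplacian vanishes there and the
    supersolution inequality would read 0 <= -1. *)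
Lemma no_flat_touching_below C z : Omega z ->
  ~ (\forall x \near z, u z - C * dotv (x - z) (x - z) <= u x).
Proof.
move=> Oz ule; pose S : 'M[R]_n := (- (2 * C))%:M.
have symS : S^T = S by rewrite tr_scalar_mx.
have := super Oz (@C2_quadf _ _ 0 z S symS Omega).
rewrite inf_laplacian_quadf // mul0mx dotv0l oppr0 sub0r quadf0 subr0.
move=> H; suff : 0 <= (-1 : R) by lra.
apply: H; apply: filterS ule => x.
rewrite /quadf dotv0l add0r mul_mx_scalar dotvZl => ux.
by rewrite lerBrDr; apply: le_trans ux; rewrite lerD2l; lra.
Qed.

Hypothesis u0 : forall x, boundary Omega x -> u x = 0.

(** An interior minimum is a flat touching from below. If the minimum over the closure lies on the
    boundary it is 0, and an interior point with u <= 0 would again be a minimum. *)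
Lemma supersolution_gt0 x : Omega x -> 0 < u x.
Proof.
move=> Ox; have cO := compact_closure_bounded.
have [|c] := compact_EVT_min _ cO cu.
  by exists x; exact: subset_closure.
rewrite inE => cc cmin; have minOf z : Omega z -> u z <= u c -> False.
  move=> Oz zc; apply: (@no_flat_touching_below 0 z Oz).
  apply: filterS (near_open Oz) => y Oy; rewrite mul0r subr0.
  by rewrite (le_trans zc) // cmin // inE; exact: subset_closure.
have [Oc|nOc] := pselect (Omega c); first by case: (minOf c Oc).
have uc0 : u c = 0 by apply: u0; apply/boundary_open.
rewrite ltNge; apply/negP => ux.
by apply: (minOf x Ox); rewrite uc0.
Qed.

(* On a sphere of radius s around y the barrier has slope - (al + be s) and
   curvature - be, so that the hypothesis makes it a strict subsolution. *)
Lemma ball_comparison y r al be :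
  [set x | enorm (x - y) <= r] `<=` Omega ->
  (forall s, 0 < s < r -> (al + be * s) ^+ 2 * be < 1) ->
  (forall x, enorm (x - y) = r -> u y - (al * r + 2^-1 * be * r ^+ 2) <= u x) ->
  forall x, enorm (x - y) <= r ->
    u y - (al * enorm (x - y) + 2^-1 * be * enorm (x - y) ^+ 2) <= u x.
Proof.
move=> ballO strict sphere.
pose g s := al * s + 2^-1 * be * s ^+ 2.
pose f x := u x + g (enorm (x - y)).
have cg : continuous g.
  move=> s; apply: continuousD; first exact: mulrl_continuous.
  by apply: continuousM; [exact: cst_continuous|exact: exprn_continuous].
have cf : {within [set x | enorm (x - y) <= r], continuous f}.
  apply: within_add.
    apply: continuous_subspaceW cu => x /ballO; exact: subset_closure.
  apply: continuous_subspaceT => x.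
  exact: (continuous_comp (@continuous_enorm_sub y x) (cg (enorm (x - y)))).
move=> x xr; rewrite lerBlDr -/(g _) -/(f x).
(* The claim says that [f] is smallest at the centre. A minimum at the centre gives it directly, one
   on the sphere by hypothesis, and any other contradicts the strict inequality. *)
have [|z] := compact_EVT_min _ (compact_ball (y := y) (r := r)) cf; first by exists x.
rewrite inE /= => zr zmin; apply: le_trans (zmin x _); last by rewrite inE.
have [zy|zy] := eqVneq z y.
  by rewrite zy /f /g subrr enorm0 expr0n /= !mulr0 !addr0.
have s0 : 0 < enorm (z - y) by rewrite enorm_gt0 // subr_eq0.
move: zr; rewrite le_eqVlt => /orP[/eqP zr|zr].
  by have := sphere z zr; rewrite lerBlDr /f /g zr.
have := @supersolution_radial R n Omega u (- (al + be * enorm (z - y))) (- be) y z.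
have -> : - ((- (al + be * enorm (z - y))) ^+ 2 * - be) =
  (al + be * enorm (z - y)) ^+ 2 * be by ring.
move=> H; suff : 1 <= (al + be * enorm (z - y)) ^+ 2 * be.
  by rewrite leNgt strict // s0.
apply: H => //; first by apply: ballO; exact: ltW.
apply/near_enormP; exists (r - enorm (z - y)); first by rewrite subr_gt0.
move=> x' x'z; have x'r : enorm (x' - y) <= r.
  by have := ler_enorm_dist x' z y; lra.
have := zmin x'; rewrite inE /f /g /radial_model => /(_ x'r).
by move: (enorm (x' - y)) (enorm (z - y)) => s' s; nra.
Qed.

End Comparison.

(** * Growth of |grad u|^4 / 4 + u along discrete ascent steps *)

Lemma lt_all_pos {R : realFieldType} (s : seq R) : all (fun a => 0 < a) s ->
  exists2 r : R, 0 < r & all (fun a => r < a) s.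
Proof.
elim: s => [_|a s IH /= /andP[a0 /IH[r r0 rs]]]; first by exists 1.
exists (Num.min a r / 2); first by rewrite divr_gt0 // lt_min a0.
have lt : Num.min a r / 2 < Num.min a r.
  by rewrite ltr_pdivrMr // ltr_pMr ?ltr1n // lt_min a0.
move: (lt); rewrite lt_min => /andP[-> ltr] /=.
by apply: sub_all rs => b; exact: lt_trans.
Qed.

Lemma dotv_sub {R : realType} {n : nat} (a b : 'rV[R]_n) :
  dotv (a - b) (a - b) = dotv a a - 2 * dotv b a + dotv b b.
Proof. by rewrite !(dotvDl, dotvDr, dotvNl, dotvNr) (dotvC a b); ring. Qed.

(** To first order the left side is - L^3 b + (1 - eta) L r = - eta L r / 2. The bound on r keeps
    the second-order term (3/2) b^2 L^2 below eta L r / 2, and the cubic and quartic terms add up to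
    at most 0. *)
Lemma ascent_estimate {R : realFieldType} (L eta r b l du : R) :
  0 < L -> 0 < eta < 1 -> 0 < r -> r < L ^+ 3 * eta / 3 ->
  0 < b -> b * L ^+ 2 = (1 - eta / 2) * r -> 0 <= l -> l <= L - b ->
  du <= L * r -> l ^+ 4 / 4 - L ^+ 4 / 4 + (1 - eta) * du < 0.
Proof.
move=> L0 /andP[eta0 eta1] r0 rL b0 Lb l0 lL duL.
have lb4 : l ^+ 4 <= (L - b) ^+ 4.
  by rewrite lerXn2r ?nnegrE // (le_trans l0).
have bL : b <= L by lra.
have b43 : b ^+ 4 <= 4 * L * b ^+ 3.
  by rewrite exprS ler_wpM2r ?exprn_ge0 ?(ltW b0) //; lra.
have E : (L - b) ^+ 4 - L ^+ 4 =
  - 4 * L * (b * L ^+ 2) + 6 * b * (b * L ^+ 2) - 4 * L * b ^+ 3 + b ^+ 4 by ring.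
have eta2 : 0 < 1 - eta / 2 by lra.
have pos : 0 < (1 - eta / 2) * r by rewrite mulr_gt0.
have ler : (1 - eta / 2) * r <= r by rewrite ger_pMl //; lra.
have bL3 : b < L * eta / 3.
  rewrite -(ltr_pM2r (exprn_gt0 2 L0)) Lb; apply: le_lt_trans ler _.
  by have -> : L * eta / 3 * L ^+ 2 = L ^+ 3 * eta / 3 by ring.
have br : b * ((1 - eta / 2) * r) < L * eta / 3 * r.
  apply: (@lt_le_trans _ _ (L * eta / 3 * ((1 - eta / 2) * r))).
    by rewrite ltr_pM2r.
  by rewrite ler_pM2l // divr_gt0 ?mulr_gt0.
have du' : (1 - eta) * du <= (1 - eta) * (L * r) by rewrite ler_pM2l //; lra.
move: E br b43 lb4 du'; rewrite Lb; clear.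
by move: (b ^+ 4) (L * b ^+ 3) => b4 b3; lra.
Qed.

Section GradientFlow.
Context {R : realType} {n : nat}.
Variables (Omega : set 'rV[R]_n) (u : 'rV[R]_n -> R) (m : R).
Implicit Types (x y z h v : 'rV[R]_n).
Hypothesis oO : open Omega.
Hypothesis bO : bounded_set Omega.
Hypothesis cu : {within closure Omega, continuous u}.
Hypothesis super : viscosity_supersolution Omega u.
Hypothesis u0 : forall x, boundary Omega x -> u x = 0.
Hypothesis um : forall x, closure Omega x -> u x <= m.
Hypothesis umE : exists2 c, closure Omega c & u c = m.

Lemma argmaxP x : argmax_set Omega u x <-> closure Omega x /\ u x = m.
Proof.
split=> -[cx]; last by move=> xm; split=> // y; rewrite xm; exact: um.
have [c cc cm] := umE => /(_ c cc); rewrite cm => mx; split=> //.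
by apply/eqP; rewrite eq_le mx um.
Qed.

Let W := Omega `\` argmax_set Omega u.

Lemma off_argmaxP x : W x <-> Omega x /\ u x < m.
Proof.
split=> -[Ox].
  move=> nK; split=> //; rewrite lt_neqAle um ?andbT; last exact: subset_closure.
  by apply/eqP => xm; apply/nK/argmaxP; split=> //; exact: subset_closure.
by move=> xm; split=> // /argmaxP[_ E]; rewrite E ltxx in xm.
Qed.

Lemma open_off_argmax : open W.
Proof.
rewrite /W setDE; apply: openI => //; rewrite openC.
have -> : argmax_set Omega u = closure Omega `&` u @^-1` [set m].
  by apply/seteqP; split => x /argmaxP.
apply: closed_within_preimage => //; first exact: closed_closure.
Qed.

Hypothesis C11 : C11_on W u.

Lemma grad_gt0 x : W x -> 0 < enorm (grad u x).
Proof.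
move=> Wx; rewrite lt_neqAle enorm_ge0 andbT eq_sym; apply/eqP => /enorm_eq0 g0.
have [C [d [C0 d0 low]]] := C11_lower_quadratic open_off_argmax C11 Wx.
apply: (@no_flat_touching_below _ _ Omega u super C x); first by case: Wx.
apply/near_enormP; exists d => // y yd.
by have := low (y - x) yd; rewrite g0 dotv0l addr0 [x + _]addrC subrK.
Qed.

(* The first integral of the smooth gradient flow, since along it
   |grad u|^2/2 has derivative inf_laplacian u = -1. *)
Definition pfunction x := enorm (grad u x) ^+ 4 / 4 + u x.

Lemma ascent_pfunction x eta e : W x -> 0 < eta < 1 -> 0 < e ->
  exists y, [/\ enorm (y - x) < e, u x < u y &
    pfunction y - eta * u y < pfunction x - eta * u x].
Proof.
move=> Wx /andP[eta0 eta1] e0.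
have [C [d [C0 d0 low]]] := C11_lower_quadratic open_off_argmax C11 Wx.
have [dW dW0 WP] := (near_enormP x W).1 (open_nbhs_nbhs (conj open_off_argmax Wx)).
have := grad_gt0 Wx; set L := enorm (grad u x) => L0.
have [nu gE nu1] : exists2 nu, grad u x = L *: nu & enorm nu = 1.
  exists (L^-1 *: grad u x); first by rewrite scalerA mulfV ?gt_eqF // scale1r.
  by rewrite enormZ gtr0_norm ?invr_gt0 // mulVf ?gt_eqF.
have nunu : dotv nu nu = 1 by rewrite -sqr_enorm nu1 expr1n.
have [C1 _] := C11; have [du _] := C1 x Wx.
have Le0 : 0 < L * eta by rewrite mulr_gt0.
have Le1 : L * eta < L by rewrite gtr_pMr.
have e10 : 0 < L * eta / 10 by rewrite divr_gt0 ?mulr_gt0.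
have [d2 d20 expn] := ray_expansion nu du e10.
(* A profile of slope close to L and curvature [- be] then has - inf_laplacian close to 1 - eta / 2,
   a strict subsolution with a margin for the variation of the slope. *)
pose be := (1 - eta / 2) / L ^+ 2.
have be0 : 0 < be by rewrite divr_gt0 ?exprn_gt0 //; lra.
have beL : be * L ^+ 2 = 1 - eta / 2 by rewrite divfK // gt_eqF // exprn_gt0.
(* In order: [y] is close to [x]; the ball around [y] stays where the lower bound holds and in [W];
   the expansion along [nu] applies; [x] minimises [u] on the ball; the slope of the profile stays
   near L; [ascent_estimate] applies. *)
have [|r r0 /= /and5P[re rd rdW rd2]] := @lt_all_pos R
  [:: e; d / 2; dW / 2; d2; L / (2 * C); L * eta / 5 / be; L ^+ 3 * eta / 3].
  by rewrite /= e0 d20 !(divr_gt0, mulr_gt0, exprn_gt0) //; lra.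
rewrite andbT => /and3P[rC rbe rL].
rewrite ltr_pdivlMr ?mulr_gt0 // in rC; rewrite ltr_pdivlMr // in rbe.
pose y := x + r *: nu.
have yx : y - x = r *: nu by rewrite /y addrC addKr.
have nyx : enorm (y - x) = r by rewrite yx enormZ nu1 mulr1 gtr0_norm.
have near2 x' : enorm (x' - y) <= r -> enorm (x' - x) <= 2 * r.
  by have := ler_enorm_dist x' y x; rewrite nyx; lra.
have ballW x' : enorm (x' - y) <= r -> W x'.
  by move=> /near2 xx; apply: WP; lra.
(* For h = x' - x the ball condition reads |h|^2 <= 2 r (nu . h), so L (nu . h) - C |h|^2 >= (L - 2
   C r) (nu . h) >= 0. *)
have xmin x' : enorm (x' - y) <= r -> u x <= u x'.
  move=> x'r; have x'x := near2 _ x'r.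
  have := low (x' - x); rewrite [x + _]addrC subrK gE dotvZl => H.
  apply: le_trans (H _); last by lra.
  have : enorm (x' - y) ^+ 2 <= r ^+ 2.
    by rewrite lerXn2r ?nnegrE ?enorm_ge0 // ltW.
  have -> : x' - y = (x' - x) - r *: nu by rewrite -yx opprB subrKA.
  move: (x' - x) => h.
  rewrite sqr_enorm dotv_sub !(dotvZl, dotvZr) nunu.
  move: (dotv nu _) (dotv_ge0 h) => a; move: (dotv _ _) => b b0 ball.
  have a0 : 0 <= a by rewrite -(pmulr_rge0 _ r0); lra.
  have : C * b <= C * (2 * r * a) by rewrite ler_pM2l //; lra.
  have : r * (2 * C) * a <= L * a by rewrite ler_wpM2r // ltW.
  lra.
(* [al] is chosen so that the profile al s + be s^2 / 2 climbs exactly u y - u x at s = r; on the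
   sphere the barrier then equals [u x]. *)
pose q := (u y - u x) / r; pose al := q - be * r / 2.
have qr : u y - u x = q * r by rewrite divfK // gt_eqF.
have := expn r; rewrite r0 => /(_ rd2).
rewrite -/y qr gE dotvZl nunu mulr1 [r * L]mulrC -mulrBl normrM (gtr0_norm r0).
rewrite ler_pM2r // ler_norml => /andP[q1 q2].
have Q := @ball_comparison R n Omega u cu super y r al be.
have {}Q x' : enorm (x' - y) <= r ->
    u y - (al * enorm (x' - y) + 2^-1 * be * enorm (x' - y) ^+ 2) <= u x'.
  apply: Q; first by move=> z /ballW[].
    move=> s /andP[s0 sr].
    have bs0 : 0 < be * s by rewrite mulr_gt0.
    have bsr : be * s < be * r by rewrite ltr_pM2l.
    (* The slope is at most q + be r / 2 and each of the two errors is at most L eta / 10;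
       strictness then follows from (1 + eta / 5)^2 (1 - eta / 2) < 1. *)
    have le : (al + be * s) ^+ 2 <= (L * (1 + eta / 5)) ^+ 2.
      have lo : 0 <= al + be * s.
        by move: bs0 rbe q1 Le0 Le1; rewrite /al; lra.
      have hi : al + be * s <= L * (1 + eta / 5).
        by move: bsr rbe q2 Le0; rewrite /al; lra.
      by rewrite lerXn2r ?nnegrE // (le_trans lo).
    apply: (le_lt_trans (ler_wpM2r (ltW be0) le)).
    have -> : (L * (1 + eta / 5)) ^+ 2 * be =
      (1 + eta / 5) ^+ 2 * (be * L ^+ 2) by ring.
    by rewrite beL; nra.
  move=> z zr; suff -> : u y - (al * r + 2^-1 * be * r ^+ 2) = u x.
    by apply: xmin; rewrite zr.
  by rewrite /al; lra.
have Wy : W y by apply: ballW; rewrite subrr enorm0 ltW.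
have [dy _] := C1 y Wy.
set Ly := enorm (grad u y).
have Ly0 : 0 <= Ly by exact: enorm_ge0.
(* The barrier has slope [al] at its vertex [y], so [u] cannot descend from [y] faster than that. *)
have Lyal : Ly <= al.
  have := grad_gt0 Wy; rewrite -/Ly => Lyp.
  have := @ray_ge R n u y (- grad u y) (- (al * Ly)) (2^-1 * be * Ly ^+ 2) dy.
  rewrite dotvNr -sqr_enorm -/Ly lerN2 expr2 ler_pM2r //; apply.
  exists (r / Ly); first by rewrite divr_gt0.
  move=> t /andP[t0]; rewrite ltr_pdivlMr // => tr.
  have E : enorm (y + t *: - grad u y - y) = t * Ly.
    by rewrite addrC addKr enormZ enormN gtr0_norm.
  by have := Q (y + t *: - grad u y); rewrite E => /(_ (ltW tr)); lra.
(* The barrier touches [u] from below at [x], where its slope towards [y] is al + be r. With the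
   previous bound the gradient norm drops by at least be r from [x] to [y]. *)
have alL : al + be * r <= L.
  have := @ray_ge R n u x nu (al + be * r) (2^-1 * be) du.
  rewrite {1}gE dotvZl nunu mulr1; apply; exists r => // t /andP[t0 tr].
  have E : enorm (x + t *: nu - y) = r - t.
    have -> : x + t *: nu - y = (t - r) *: nu.
      by rewrite /y opprD addrACA subrr add0r scalerBl.
    by rewrite enormZ nu1 mulr1 distrC gtr0_norm // subr_gt0.
  have := Q (x + t *: nu); rewrite E => H; have {H} := H _.
  rewrite /al; nra.
exists y; split; first by rewrite nyx.
  by rewrite -subr_gt0 qr mulr_gt0 //; nra.
rewrite /pfunction -/L -/Ly.
have b0 : 0 < be * r by rewrite mulr_gt0.
have uy : u y - u x <= L * r.
  rewrite qr ler_pM2r //; apply: le_trans alL; rewrite /al -addrA lerDl.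
  by rewrite addrC subr_ge0 ler_pdivrMr // ler_pMr // ler1n.
have Lb : be * r * L ^+ 2 = (1 - eta / 2) * r by rewrite mulrAC beL.
have LyL : Ly <= L - be * r by move: Lyal alL; lra.
have etaI : 0 < eta < 1 by rewrite eta0.
by have := ascent_estimate L0 etaI r0 rL b0 Lb Ly0 LyL uy; lra.
Qed.

End GradientFlow.

(** * Fourth roots and the one-dimensional profile *)

Section QuarticRoot.
Context {R : realType}.

(** Fourth root, with value 0 on negative arguments. *)
Definition qroot (a : R) : R := Num.sqrt (Num.sqrt a).

Lemma qroot_ge0 a : 0 <= qroot a.
Proof. exact: sqrtr_ge0. Qed.

Lemma qrootK a : 0 <= a -> qroot a ^+ 4 = a.
Proof. by move=> a0; rewrite (exprM _ 2 2) !sqr_sqrtr ?sqrtr_ge0. Qed.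

Lemma qroot_gt0 a : 0 < a -> 0 < qroot a.
Proof. by move=> a0; rewrite !sqrtr_gt0. Qed.

Lemma qroot0 : qroot 0 = 0.
Proof. by rewrite /qroot !sqrtr0. Qed.

Lemma ler_qroot a b : a <= b -> qroot a <= qroot b.
Proof. by move=> ab; rewrite !ler_wsqrtr. Qed.

Lemma qroot_continuous : continuous qroot.
Proof. by move=> a; apply: continuous_comp; exact: sqrt_continuous. Qed.

Lemma differentiable_qroot (a : R) : 0 < a -> differentiable qroot a.
Proof.
move=> a0; have dsqrt (b : R) : 0 < b -> differentiable (@Num.sqrt R) b.
  by move=> b0; apply/derivable1_diffP; have [] := is_derive1_sqrt b0.
by apply: differentiable_comp; apply: dsqrt; rewrite ?sqrtr_gt0.
Qed.

Lemma differentiable_cube (a : R) : differentiable (fun t : R => t ^+ 3) a.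
Proof. by apply/derivable1_diffP; exact: exprn_derivable. Qed.

(** Lets perturbation parameters tend to 0 in bounds proved with strict ones. *)
Lemma continuous_ge_right (g : R -> R) (c : R) : {for 0, continuous g} ->
  (forall t, 0 < t -> c <= g t) -> c <= g 0.
Proof.
move=> cg cle; rewrite leNgt; apply/negP => lt.
have /cg/nbhs_normP[e /= e0 eP] : nbhs (g 0) [set t | t < c] by exact: lt_nbhsl.
have := eP (e / 2); rewrite /= sub0r normrN gtr0_norm ?divr_gt0 //.
rewrite ltr_pdivrMr // ltr_pMr // ltr1n => /(_ isT).
by rewrite ltNge cle ?divr_gt0.
Qed.

(* Taylor bound for s |-> (l ^ 4 - (l ^ 3 - 3 k s) ^ (4/3)) / 4, the profile of
   the one-dimensional solution; writing l ^ 3 - 3 k s = mu ^ 3 makes it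
   polynomial, and k > 1 leaves room for the remainder. *)
Lemma quartic_le_parabola (k l mu s : R) : 1 < k -> 0 < l ->
  s <= k * l ^+ 3 -> l ^+ 3 - mu ^+ 3 <= 3 * k * s ->
  0 < 3 * k ^+ 2 * l ^+ 2 * (3 * mu ^+ 2 + 2 * mu * l + l ^+ 2) -
      2 * ((l ^+ 2 + l * mu + mu ^+ 2) * (l ^+ 2 + l * mu + mu ^+ 2)) ->
  (l ^+ 4 - mu ^+ 4) / 4 <= k * l * s + 2^-1 * - (l ^+ 2)^-1 * s ^+ 2.
Proof.
move=> k1 l0 sle sge psi; have k0 : 0 < k by rewrite (lt_trans _ k1).
have l20 : 0 < l ^+ 2 by rewrite exprn_gt0.
(* [s'] turns the hypothesis on mu into an equality. The parabola [p] increases up to k l^3, so it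
   suffices to treat [s']; there the difference is (l - mu)^2 times the expression assumed positive,
   up to a positive factor. *)
pose s' := (l ^+ 3 - mu ^+ 3) / (3 * k).
have s'E : l ^+ 3 - mu ^+ 3 = 3 * k * s' by rewrite /s'; field; rewrite gt_eqF.
have s's : s' <= s by rewrite ler_pdivrMr ?mulr_gt0 // mulrC.
pose p s := k * l * s + 2^-1 * - (l ^+ 2)^-1 * s ^+ 2.
apply: (@le_trans _ _ (p s')).
  rewrite -subr_ge0 -(pmulr_rge0 _ l20) -(pmulr_rge0 _ (exprn_gt0 2 k0)).
  have -> : k ^+ 2 * (l ^+ 2 * (p s' - (l ^+ 4 - mu ^+ 4) / 4)) =
    (l - mu) ^+ 2 / 36 * (3 * k ^+ 2 * l ^+ 2 * (3 * mu ^+ 2 + 2 * mu * l + l ^+ 2) -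
      2 * ((l ^+ 2 + l * mu + mu ^+ 2) * (l ^+ 2 + l * mu + mu ^+ 2))).
    by rewrite /p /s'; field; rewrite !gt_eqF.
  by rewrite mulr_ge0 ?(ltW psi) // divr_ge0 ?sqr_ge0.
rewrite -subr_ge0.
have -> : k * l * s + 2^-1 * - (l ^+ 2)^-1 * s ^+ 2 - p s' =
    (s - s') / l ^+ 2 * (k * l ^+ 3 - (s + s') / 2).
  by rewrite /p; field; rewrite gt_eqF.
by rewrite mulr_ge0 ?divr_ge0 ?subr_ge0 ?(ltW l20) //; lra.
Qed.

End QuarticRoot.

(** * Subsolutions: D lies below the boundary distance *)

Section Eikonal.
Context {R : realType} {n : nat}.
Variables (Omega : set 'rV[R]_n) (u : 'rV[R]_n -> R) (m : R).
Implicit Types (x y z h v : 'rV[R]_n).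
Hypothesis oO : open Omega.
Hypothesis bO : bounded_set Omega.
Hypothesis cu : {within closure Omega, continuous u}.
Hypothesis u0 : forall x, boundary Omega x -> u x = 0.
Hypothesis um : forall x, closure Omega x -> u x <= m.

(* (4 (a - u x)) ^ (3/4); for a = max u, ((4 a) ^ (3/4) - gap a) / 3 will turn
   out to be the distance to the boundary off argmax u. *)
Definition gap (a : R) (x : 'rV[R]_n) : R := qroot (4 * (a - u x)) ^+ 3.

Lemma within_gap (a c : R) y :
  {within closure Omega, continuous (fun x => gap a x + c * enorm (x - y))}.
Proof.
apply: within_add.
  apply: (@within_comp _ _ _ u (fun t => qroot (4 * (a - t)) ^+ 3)) => // t.
  apply: (@continuous_comp _ _ _ (fun t => qroot (4 * (a - t))) (fun t => t ^+ 3)).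
    apply: (@continuous_comp _ _ _ (fun t => 4 * (a - t)) qroot).
      apply: continuousM; first exact: cst_continuous.
      by apply: continuousB; [exact: cst_continuous|].
    exact: qroot_continuous.
  exact: exprn_continuous.
apply: continuous_subspaceT => x.
exact: (continuous_comp (@continuous_enorm_sub R n y x) (@mulrl_continuous _ c _)).
Qed.

Section upper.
Hypothesis sub : viscosity_subsolution Omega u.

(** At a minimum of the right side on the boundary, u = 0 gives the bound. At an interior one [u] is
    touched from above by a radial profile whose - inf_laplacian is k^2 > 1. Taking a > m keeps the
    fourth root positive, so the curvature is finite. *)
Lemma gap_ge_strict a k y x : m < a -> 1 < k -> boundary Omega y -> Omega x ->
  qroot (4 * a) ^+ 3 <= gap a x + 3 * k * enorm (x - y).
Proof.
move=> ma k1 dy Ox.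
have [|z] := compact_EVT_min _ (compact_closure_bounded bO)
  (@within_gap a (3 * k) y).
  by exists x; exact: subset_closure.
rewrite inE => cz zmin.
have cx : closure Omega x by exact: subset_closure.
apply: le_trans (zmin x _); last by rewrite inE.
have k0 : 0 < k by rewrite (lt_trans _ k1).
have [Oz|nOz] := pselect (Omega z); last first.
  have -> : gap a z = qroot (4 * a) ^+ 3.
    by rewrite /gap u0 ?subr0 //; apply/boundary_open.
  by rewrite lerDl mulr_ge0 ?enorm_ge0 // mulr_ge0 // ltW.
exfalso.
have zy : z != y by apply/eqP => E; have [_] := (boundary_open oO y).1 dy; rewrite -E.
have lamP x' : closure Omega x' -> 0 < 4 * (a - u x').
  by move=> /um le; rewrite mulr_gt0 // subr_gt0; exact: le_lt_trans ma.
pose la x' := qroot (4 * (a - u x')).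
have l0 : 0 < la z by apply: qroot_gt0; exact: lamP.
(* Slope k l and curvature - 1 / l^2 come from expanding (l^4 - (l^3 - 3 k s)^(4/3)) / 4 to second
   order, with the curvature - k^2 / l^2 weakened. *)
have := @subsolution_radial R n Omega u (k * la z) (- (la z ^+ 2)^-1) y z Oz zy sub.
have -> : - ((k * la z) ^+ 2 * - (la z ^+ 2)^-1) = k ^+ 2.
  by field; rewrite gt_eqF // exprn_gt0.
move=> H; suff : k ^+ 2 <= 1.
  by rewrite leNgt exprn_egt1.
apply: H.
have cla : {for z, continuous la}.
  apply: (@continuous_comp _ _ _ u (fun t => qroot (4 * (a - t)))).
    exact: continuous_interior Oz.
  apply: (@continuous_comp _ _ _ (fun t => 4 * (a - t)) qroot).
    apply: continuousM; first exact: cst_continuous.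
    by apply: continuousB; [exact: cst_continuous|].
  exact: qroot_continuous.
pose psi (l mu : R) := 3 * k ^+ 2 * l ^+ 2 * (3 * mu ^+ 2 + 2 * mu * l + l ^+ 2) -
      2 * ((l ^+ 2 + l * mu + mu ^+ 2) * (l ^+ 2 + l * mu + mu ^+ 2)).
have cpsi : {for z, continuous (fun x => psi (la z) (la x))}.
  apply: (@continuous_comp _ _ _ la (psi (la z))) => //.
  pose q : {poly R} := (la z ^+ 2)%:P + la z *: 'X + 'X^2.
  pose p : {poly R} := (3 * k ^+ 2 * la z ^+ 2) *:
    (3 *: 'X^2 + (2 * la z) *: 'X + (la z ^+ 2)%:P) - 2 *: (q * q).
  have -> : psi (la z) = horner p.
    by apply/funext => mu; rewrite /psi /p /q !hornerE; ring.
  exact: continuous_horner.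
(* At mu = l the expression is 18 l^4 (k^2 - 1) > 0, and continuity extends the sign to nearby
   points. *)
have near1 : \forall x' \near z, 0 < psi (la z) (la x').
  apply: (cpsi [set t | 0 < t]); apply: lt_nbhsr.
  have -> : psi (la z) (la z) = 18 * la z ^+ 4 * (k ^+ 2 - 1) by rewrite /psi; ring.
  by rewrite mulr_gt0 ?mulr_gt0 ?exprn_gt0 // subr_gt0 exprn_egt1.
have near2 : \forall x' \near z, enorm (x' - y) < enorm (z - y) + k * la z ^+ 3.
  apply: (@continuous_enorm_sub _ _ y z [set t | t < _]); apply: lt_nbhsl.
  by rewrite ltrDl mulr_gt0 // exprn_gt0.
apply: filterS (filterI (near_open oO Oz) (filterI near1 near2)) => x' [Ox' [n1 n2]].
have cx' : closure Omega x' by exact: subset_closure.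
have := zmin x'; rewrite inE => /(_ cx'); rewrite /gap -/(la z) -/(la x') => le.
have uE w : closure Omega w -> u w = a - la w ^+ 4 / 4.
  by move=> cw; rewrite /la qrootK ?ltW ?lamP //; lra.
rewrite (uE z cz) (uE x' cx') /radial_model.
set s := enorm (x' - y) - enorm (z - y).
suff : (la z ^+ 4 - la x' ^+ 4) / 4 <=
    k * la z * s + 2^-1 * - (la z ^+ 2)^-1 * s ^+ 2 by lra.
apply: quartic_le_parabola => //; first by rewrite /s; lra.
by rewrite /s; lra.
Qed.

Lemma gap_ge y x : boundary Omega y -> Omega x ->
  qroot (4 * m) ^+ 3 - 3 * enorm (x - y) <= gap m x.
Proof.
move=> dy Ox; rewrite lerBlDr.
(* One parameter sends [a] to [m] and [k] to 1 together. *)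
pose g t := gap (m + t) x + 3 * (1 + t) * enorm (x - y).
have -> : gap m x + 3 * enorm (x - y) = g 0 by rewrite /g !addr0 mulr1.
apply: continuous_ge_right => [|t t0].
  apply: continuousD; last first.
    apply: continuousM; last exact: cst_continuous.
    apply: continuousM; first exact: cst_continuous.
    by apply: continuousD; [exact: cst_continuous|].
  apply: (@continuous_comp _ _ _ (fun t => qroot (4 * (m + t - u x))) (fun t => t ^+ 3)).
    apply: (@continuous_comp _ _ _ (fun t => 4 * (m + t - u x)) qroot).
      apply: continuousM; first exact: cst_continuous.
      apply: continuousB; last exact: cst_continuous.
      by apply: continuousD; [exact: cst_continuous|].
    exact: qroot_continuous.
  exact: exprn_continuous.
apply: (@le_trans _ _ (qroot (4 * (m + t)) ^+ 3)).
  by rewrite lerXn2r ?nnegrE ?qroot_ge0 // ler_qroot //; lra.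
by apply: gap_ge_strict => //; lra.
Qed.
End upper.
End Eikonal.

(** * Locality of differentiability and the boundary distance *)

Lemma near_eq_differentiable {R : numFieldType} {V W : normedModType R}
    (f g : V -> W) (x : V) :
  differentiable f x -> (\forall y \near x, f y = g y) -> differentiable g x.
Proof.
move=> df fg; have fgx : f x = g x by exact: (nbhs_singleton fg).
have [cdf expf] := (diff_locallyP x f).1 df.
have expg : g \o shift x = cst (g x) + 'd f x +o_ 0 id.
  apply/eqaddoP => e e0; have := (eqaddoP _ _ _ _).1 expf e e0.
  have fg0 : \forall h \near 0, f (h + x) = g (h + x).
    by rewrite (near_shift 0 x) in fg; apply: filterS fg => h /=; rewrite subr0.
  by apply: filterS2 fg0 => h; rewrite /= !fctE /= => -> ; rewrite fgx.
apply/diff_locallyP; split.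
  by rewrite (diff_unique cdf expg).
by rewrite (diff_unique cdf expg).
Qed.

Section BoundaryDistance.
Context {R : realType} {n : nat}.
Variables (Omega : set 'rV[R]_n).
Implicit Types (x y z h v : 'rV[R]_n).
Hypothesis dO : boundary Omega !=set0.

Lemma bdist_le x y : boundary Omega y -> bdist Omega x <= enorm (x - y).
Proof.
move=> dy; apply: ge_inf; last by exists y.
by exists 0 => _ [z _ <-]; exact: enorm_ge0.
Qed.

Lemma bdist_ge c x : (forall y, boundary Omega y -> c <= enorm (x - y)) ->
  c <= bdist Omega x.
Proof.
move=> cle; apply: lb_le_inf.
  by have [y dy] := dO; exists (enorm (x - y)), y.
by move=> _ [z dz <-]; exact: cle.
Qed.

Lemma bdist_lipschitz x y : bdist Omega x - enorm (x - y) <= bdist Omega y.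
Proof.
apply: bdist_ge => z dz; rewrite lerBlDl.
exact: le_trans (bdist_le _ dz) (ler_enorm_dist _ _ _).
Qed.

Lemma bdist_boundary x : boundary Omega x -> bdist Omega x = 0.
Proof.
move=> dx; apply/eqP; rewrite eq_le; apply/andP; split.
  by have := bdist_le x dx; rewrite subrr enorm0.
by apply: bdist_ge => y _; exact: enorm_ge0.
Qed.

Hypothesis oO : open Omega.
Hypothesis bO : bounded_set Omega.

Lemma bdist_attained x : exists2 y, boundary Omega y & bdist Omega x = enorm (x - y).
Proof.
have cB : compact (boundary Omega).
  apply: (subclosed_compact _ (compact_closure_bounded bO)); last by move=> y [].
  rewrite /boundary setDE; apply: closedI; first exact: closed_closure.
  by rewrite closedC; exact: open_interior.
have cf : {within boundary Omega, continuous (fun y => enorm (y - x))}.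
  by apply: continuous_subspaceT; exact: continuous_enorm_sub.
have [y] := compact_EVT_min dO cB cf; rewrite inE => dy ymin; exists y => //.
apply/eqP; rewrite eq_le bdist_le //=; apply: bdist_ge => z dz.
by rewrite (enorm_distC x) (enorm_distC x) ymin // inE.
Qed.

(* At an interior maximum the gradient would vanish, but bdist has slope -1
   towards a nearest boundary point. *)
Lemma bdist_max_singular x : Omega x ->
  (forall y, Omega y -> bdist Omega y <= bdist Omega x) ->
  singular_set Omega x.
Proof.
move=> Ox xmax; split=> // dx; have [y dy dE] := bdist_attained x.
have d0 : 0 < bdist Omega x.
  rewrite dE enorm_gt0 // subr_eq0; apply/eqP => E.
  by have [_] := (boundary_open oO y).1 dy; rewrite -E.
have := @ray_le R n (bdist Omega) x (y - x) (- bdist Omega x) 0 dx _.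
have := @ray_le R n (bdist Omega) x (- (y - x)) 0 0 dx _.
move=> H1 H2; suff : 0 <= dotv (grad (bdist Omega) x) (y - x) <= - bdist Omega x.
  by move=> /andP[a b]; have := le_trans a b; rewrite leNgt oppr_lt0 d0.
apply/andP; split.
  rewrite -oppr_le0 -dotvNr; apply: H1.
  have [e e0 eP] := (near_enormP x _).1 (near_open oO Ox).
  exists (e / bdist Omega x); first by rewrite divr_gt0.
  move=> t /andP[t0]; rewrite ltr_pdivlMr // => te.
  rewrite mul0r mul0r addr0 subr_le0; apply/xmax/eP.
  by rewrite addrC addKr opprB enormZ gtr0_norm // -dE.
apply: H2; exists 1 => // t /andP[t0 t1].
rewrite mul0r addr0 lerBlDl.
apply: le_trans (bdist_le _ dy) _.
have -> : x + t *: (y - x) - y = (1 - t) *: (x - y).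
  by rewrite scalerBl scale1r -(opprB x y) scalerN addrAC.
by rewrite enormZ gtr0_norm ?subr_gt0 // dE; lra.
Qed.

End BoundaryDistance.

(** * C^{1,1} supersolutions: D lies above the boundary distance *)

Section EikonalSolution.
Context {R : realType} {n : nat}.
Variables (Omega : set 'rV[R]_n) (u : 'rV[R]_n -> R) (m : R).
Implicit Types (x y z h v : 'rV[R]_n).
Hypothesis oO : open Omega.
Hypothesis bO : bounded_set Omega.
Hypothesis cu : {within closure Omega, continuous u}.
Hypothesis super : viscosity_supersolution Omega u.
Hypothesis u0 : forall x, boundary Omega x -> u x = 0.
Hypothesis um : forall x, closure Omega x -> u x <= m.
Hypothesis umE : exists2 c, closure Omega c & u c = m.
Let W := Omega `\` argmax_set Omega u.
Hypothesis C11 : C11_on W u.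

Lemma continuous_pfunction x : W x -> {for x, continuous (pfunction u)}.
Proof.
move=> Wx; have [C1 _] := C11; have [du cg] := C1 x Wx.
apply: continuousD; last exact: differentiable_continuous.
apply: (@continuous_comp _ _ _ (fun x => enorm (grad u x)) (fun t => t ^+ 4 / 4)).
  by apply: continuous_comp => //; exact: enorm_continuous.
by apply: continuousM; [exact: exprn_continuous|exact: cst_continuous].
Qed.

Lemma pfunction_ge x : W x -> m <= pfunction u x.
Proof.
move=> Wx; have [Ox xm] := (off_argmaxP um umE x).1 Wx.
have ux0 := supersolution_gt0 oO bO cu super u0 Ox.
have Pu z : u z <= pfunction u z.
  by rewrite lerDr divr_ge0 // exprn_ge0 // enorm_ge0.
rewrite leNgt; apply/negP => Px.
pose l := (pfunction u x + m) / 2.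
have xl : pfunction u x < l by rewrite /l; lra.
have lm : l < m by rewrite /l; lra.
have l0 : 0 < l by have := Pu x; lra.
(* Then P x = (1 - 2 eta) l, while P - eta u >= (1 - eta) l on the level u = l; so the minimum over
   the band is not on the top level. *)
pose eta := (l - pfunction u x) / (2 * l).
have etaE : eta * (2 * l) = l - pfunction u x by rewrite divfK // gt_eqF // mulr_gt0.
have eta0 : 0 < eta by apply: divr_gt0; lra.
have eta1 : eta < 1 by rewrite ltr_pdivrMr; have := Pu x; lra.
(* The levels lie strictly between 0 and [m], so the band avoids the boundary and the argmax set. *)
pose S := closure Omega `&` u @^-1` [set t | u x <= t <= l].
have cS : compact S.
  apply: (subclosed_compact _ (compact_closure_bounded bO)); last by move=> y [].
  apply: closed_within_preimage => //; first exact: closed_closure.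
  have -> : [set t | u x <= t <= l] = [set t | u x <= t] `&` [set t | t <= l].
    by apply/seteqP; split => t /= => [/andP[]|[-> ->]].
  by apply: closedI; [exact: closed_ge|exact: closed_le].
have SW z : S z -> W z.
  move=> [cz /= /andP[z1 z2]]; apply/(off_argmaxP um umE); split; last lra.
  by apply: contrapT => nOz; have := u0 ((boundary_open oO z).2 (conj cz nOz)); lra.
have cG : {within S, continuous (fun z => pfunction u z - eta * u z)}.
  apply: continuous_in_subspaceT => z; rewrite inE => /SW Wz.
  apply: continuousB; first exact: continuous_pfunction.
  apply: continuousM; first exact: cst_continuous.
  by apply: continuous_interior => //; case: Wz.
have Sx : S x.
  by split; [exact: subset_closure|rewrite /= lexx ltW // (le_lt_trans (Pu x))].
have [|z] := compact_EVT_min _ cS cG; first by exists x.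
rewrite inE => Sz zmin; have Wz := SW z Sz.
have := zmin x; rewrite inE => /(_ Sx) zx.
have [cz /= /andP[xz zl]] := Sz.
have {zl} zl : u z < l.
  rewrite lt_neqAle zl andbT; apply/eqP => zE.
  by rewrite zE in zx; have := Pu z; rewrite zE; nra.
have cuz : {for z, continuous u} by apply: continuous_interior => //; case: Wz.
have near : \forall y \near z, Omega y /\ u y < l.
  apply: filterI; first by apply: near_open => //; case: Wz.
  by apply: (cuz [set t | t < l]); exact: lt_nbhsl.
have [e e0 eP] := (near_enormP z _).1 near.
have etaI : 0 < eta < 1 by rewrite eta0.
(* The ascent step raises [u] but stays so close to [z] that [u] remains below [l]: [y] is in the
   band and beats the minimum. *)
have [y [yz zy Gyz]] := ascent_pfunction oO cu super um umE C11 Wz etaI e0.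
have [Oy yl] := eP y yz.
have := zmin y; rewrite inE leNgt Gyz => H; suff : false by []; apply: H.
split; first exact: subset_closure.
by rewrite /= (ltW yl) (le_trans xz) // ltW.
Qed.

Lemma gap_gt0 x : W x -> 0 < gap u m x.
Proof.
move=> /(off_argmaxP um umE)[_ xm].
by rewrite exprn_gt0 // qroot_gt0 // mulr_gt0 // subr_gt0.
Qed.

Lemma gap_argmax x : argmax_set Omega u x -> gap u m x = 0.
Proof.
by move=> /(argmaxP um umE)[_ E]; rewrite /gap E subrr mulr0 qroot0 expr0n.
Qed.

Lemma pfunction_grad_ge x : W x -> qroot (4 * (m - u x)) <= enorm (grad u x).
Proof.
move=> Wx; have := pfunction_ge Wx; rewrite /pfunction => Px.
have [_ xm] := (off_argmaxP um umE x).1 Wx.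
rewrite -(@ler_pXn2r _ 4) ?nnegrE ?qroot_ge0 ?enorm_ge0 //.
by rewrite qrootK; lra.
Qed.

(** Take a maximum point z of gap - 3 k |. - x|. On the boundary, where gap is (4 m)^(3/4), it gives
    the bound; on the argmax set gap is 0 < gap x; elsewhere gap would have to rise more slowly
    along steepest descent than |grad u| allows. *)
Lemma bdist_le_gap_strict k x : 0 < k < 1 -> W x ->
  3 * k * bdist Omega x <= qroot (4 * m) ^+ 3 - gap u m x.
Proof.
move=> /andP[k0 k1] Wx.
have cF : {within closure Omega,
    continuous (fun y => - (gap u m y + - (3 * k) * enorm (y - x)))}.
  apply: (@within_comp _ _ _ _ -%R); last exact: opp_continuous.
  exact: within_gap.
have cx : closure Omega x by case: Wx => Ox _; exact: subset_closure.
have [|z] := compact_EVT_min _ (compact_closure_bounded bO) cF; first by exists x.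
rewrite inE => cz zmin.
have zx : gap u m x - gap u m z + 3 * k * enorm (z - x) <= 0.
  have := zmin x; rewrite inE subrr enorm0 => /(_ cx).
  by move: (enorm _) => s; lra.
have [Oz|nOz] := pselect (Omega z); last first.
  have dz : boundary Omega z by apply/boundary_open.
  move: zx; rewrite {2}/gap (u0 dz) subr0 enorm_distC => zx.
  have : 3 * k * bdist Omega x <= 3 * k * enorm (x - z).
    by rewrite ler_pM2l ?mulr_gt0 // bdist_le.
  lra.
exfalso.
have ks : 0 <= 3 * k * enorm (z - x) by rewrite mulr_ge0 ?enorm_ge0 // mulr_ge0 // ltW.
have gx := gap_gt0 Wx.
have [Kz|nKz] := pselect (argmax_set Omega u z).
  by move: zx; rewrite (gap_argmax Kz); lra.
have Wz : W z by [].
have gz := pfunction_grad_ge Wz.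
have [C1 _] := C11; have [du _] := C1 z Wz.
have [_ zm] := (off_argmaxP um umE z).1 Wz.
set la := qroot (4 * (m - u z)) in gz.
have l0 : 0 < la by rewrite qroot_gt0 // mulr_gt0 // subr_gt0.
set L := enorm (grad u z) in gz; have L0 : 0 < L by exact: lt_le_trans gz.
have lak : la * k < la by rewrite gtr_pMr.
(* Since u = m - gap^(4/3) / 4, a rise of gap at rate 3 k lowers [u] at rate la k. The last constant
   collects the higher-order terms of (la + a)^4 / 4 with a = k t / la^2. *)
have := @ray_ge R n u z (- (L^-1 *: grad u z)) (- (la * k))
  ((6 * la ^+ 2 + 4 * la + 1) / 4 * (k / la ^+ 2) ^+ 2) du.
rewrite dotvNr dotvZr -sqr_enorm -/L [L ^+ 2]expr2 mulKf ?gt_eqF // lerN2 => H.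
suff : L <= la * k by lra.
apply: H; have [e e0 eP] := (near_enormP z _).1 (near_open oO Oz).
(* The second bound makes a <= 1. *)
exists (Num.min e (la ^+ 2 / k)); first by rewrite lt_min e0 divr_gt0 // exprn_gt0.
move=> t /andP[t0]; rewrite lt_min => /andP[te tk].
set w := z + _.
have wz : enorm (w - z) = t.
  rewrite /w addrC addKr scalerN enormN !enormZ !gtr0_norm ?invr_gt0 //.
  by rewrite mulVf ?gt_eqF // mulr1.
have Ow : Omega w by apply: eP; rewrite wz.
have cw : closure Omega w by exact: subset_closure.
have := zmin w; rewrite inE => /(_ cw) zw.
have tri := ler_enorm_dist w z x; rewrite wz in tri.
have {zw} : gap u m w <= gap u m z + 3 * k * t.
  have : 3 * k * enorm (w - x) <= 3 * k * (t + enorm (z - x)).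
    by rewrite ler_pM2l // mulr_gt0.
  lra.
rewrite /gap -/la; set mu := qroot _ => mula.
have uz : u z = m - la ^+ 4 / 4 by rewrite qrootK //; lra.
have uw : u w = m - mu ^+ 4 / 4 by rewrite qrootK //; have := um cw; lra.
pose a := k / la ^+ 2 * t.
have a0 : 0 < a by rewrite !mulr_gt0 // invr_gt0 exprn_gt0.
have aE : la ^+ 2 * a = k * t by rewrite /a; field; rewrite gt_eqF.
have a1 : a <= 1.
  rewrite -(ler_pM2l (exprn_gt0 2 l0)) aE mulr1 mulrC -ler_pdivlMr //; exact: ltW.
(* The linear term of (la + a)^3 is 3 la^2 a = 3 k t, the whole allowed rise of gap. *)
have mua : mu <= la + a.
  rewrite -(@ler_pXn2r _ 3) ?nnegrE ?qroot_ge0 ?addr_ge0 ?(ltW l0) ?(ltW a0) //.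
  apply: le_trans mula _.
  have -> : (la + a) ^+ 3 = la ^+ 3 + 3 * (la ^+ 2 * a) + (3 * la + a) * a ^+ 2 by ring.
  have : 0 <= (3 * la + a) * a ^+ 2 by rewrite mulr_ge0 ?sqr_ge0 //; lra.
  by rewrite aE; lra.
have mu4 : mu ^+ 4 <= (la + a) ^+ 4.
  by rewrite lerXn2r ?nnegrE ?qroot_ge0 ?addr_ge0 ?(ltW l0) ?(ltW a0).
have E4 : (la + a) ^+ 4 <=
    la ^+ 4 + 4 * la * (k * t) + (6 * la ^+ 2 + 4 * la + 1) * a ^+ 2.
  have -> : (la + a) ^+ 4 = la ^+ 4 + 4 * la * (la ^+ 2 * a) +
    (6 * la ^+ 2 + 4 * la * a + a * a) * a ^+ 2 by ring.
  rewrite aE lerD2l ler_wpM2r ?sqr_ge0 // lerD ?lerD2l //.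
    by rewrite ger_pMr // mulr_gt0.
  by rewrite mulr_ile1 // ltW.
rewrite uz uw -(mulrA _ (_ ^+ 2) (t ^+ 2)) -exprMn -/a.
by move: (la * k * t) E4 mu4 => b; lra.
Qed.

Lemma bdist_le_gap x : W x -> 3 * bdist Omega x <= qroot (4 * m) ^+ 3 - gap u m x.
Proof.
move=> Wx; set c := _ - _; set d := bdist Omega x.
rewrite leNgt; apply/negP => lt.
have gx := gap_gt0 Wx.
have c0 : 0 <= c.
  rewrite subr_ge0 /gap lerXn2r ?nnegrE ?qroot_ge0 // ler_qroot //.
  have [Ox _] := Wx; have := supersolution_gt0 oO bO cu super u0 Ox; lra.
have d0 : 0 < 3 * d by lra.
(* The midpoint lies below 1, yet is large enough that 3 k d > c. *)
pose k := (c / (3 * d) + 1) / 2.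
have cd1 : c / (3 * d) < 1 by rewrite ltr_pdivrMr // mul1r.
have cd0 : 0 <= c / (3 * d) by rewrite divr_ge0 // ltW.
have := @bdist_le_gap_strict k x _ Wx; rewrite -/c -/d => H.
have {H} : 3 * k * d <= c by apply: H; rewrite /k; lra.
apply/negP; rewrite -ltNge mulrAC -ltr_pdivrMl //.
by rewrite mulrC /k; lra.
Qed.

End EikonalSolution.

(** * Coincidence of the cut locus and the high ridge with the argmax set *)

Section CutLocus.
Context {R : realType} {n : nat}.
Variables (Omega : set 'rV[R]_n) (u : 'rV[R]_n -> R).
Implicit Types (x y z h v : 'rV[R]_n).
Hypothesis O0 : Omega !=set0.
Hypothesis oO : open Omega.
Hypothesis bO : bounded_set Omega.
Hypothesis dO : boundary Omega !=set0.
Hypothesis sol : dirichlet_solution Omega u.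
Hypothesis C11 : C11_on (Omega `\` argmax_set Omega u) u.

Lemma C11_cut_locus : cut_locus Omega = high_ridge Omega.
Proof.
have [cu u0 sub super] := sol.
have [x0 Ox0] := O0.
have cO : compact (closure Omega) by exact: compact_closure_bounded.
have [|c] := compact_EVT_max _ cO cu; first by exists x0; exact: subset_closure.
rewrite inE => cc cmax; set m := u c in cmax.
have um x : closure Omega x -> u x <= m by move=> cx; apply: cmax; rewrite inE.
have umE : exists2 c, closure Omega c & u c = m by exists c.
have m0 : 0 < m.
  apply: lt_le_trans (um x0 (subset_closure Ox0)).
  exact: supersolution_gt0 super u0 _ Ox0.
set K := argmax_set Omega u; pose a := qroot (4 * m) ^+ 3.
have a0 : 0 < a by rewrite exprn_gt0 // qroot_gt0 // mulr_gt0.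
have KO x : K x -> Omega x.
  move=> /(argmaxP um umE)[cx xm]; apply: contrapT => nOx.
  have := u0 x ((boundary_open oO x).2 (conj cx nOx)).
  by rewrite xm => E; rewrite E ltxx in m0.
have gap_le x : Omega x -> a - gap u m x <= 3 * bdist Omega x.
  move=> Ox; suff : (a - gap u m x) / 3 <= bdist Omega x by lra.
  apply: bdist_ge => // y dy; have := gap_ge oO bO cu u0 um sub dy Ox.
  by rewrite -/a; lra.
have dW x : (Omega `\` K) x -> bdist Omega x = (a - gap u m x) / 3.
  move=> Wx; have [Ox _] := Wx.
  have := gap_le x Ox.
  have := bdist_le_gap oO bO cu super u0 um umE C11 Wx.
  by rewrite -/a; lra.
have dK x : K x -> bdist Omega x = a / 3.
  move=> Kx; have Ox := KO x Kx; have := gap_le x Ox.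
  rewrite (gap_argmax um umE Kx) => ge.
  apply/eqP; rewrite eq_le; apply/andP; split; last lra.
  rewrite leNgt; apply/negP => gt.
  (* Off [K] the distance is below a / 3, so a larger value at [x] would put a neighbourhood of [x]
     in [K]; there [u] is constant, hence flat. *)
  have flat : \forall y \near x, K y.
    have [e e0 eP] := (near_enormP x _).1 (near_open oO Ox).
    apply/near_enormP; exists (Num.min e (bdist Omega x - a / 3)).
      by rewrite lt_min e0 subr_gt0.
    move=> y; rewrite lt_min => /andP[/eP Oy yx]; apply: contrapT => nKy.
    have Wy : (Omega `\` K) y by [].
    have := bdist_lipschitz dO x y; rewrite (dW y Wy) enorm_distC.
    by have := gap_gt0 um umE Wy; lra.
  apply: (@no_flat_touching_below _ _ Omega u super 0 x Ox).
  apply: filterS flat => y /(argmaxP um umE)[_ ->].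
  by rewrite mul0r subr0; apply/um/subset_closure.
have dle x : closure Omega x -> bdist Omega x <= a / 3.
  move=> cx; have [Kx|nKx] := pselect (K x); first by rewrite dK.
  have [Ox|nOx] := pselect (Omega x).
    rewrite dW //; have := @gap_gt0 _ _ _ _ _ um umE x (conj Ox nKx); lra.
  by rewrite bdist_boundary //; [lra|apply/boundary_open].
have Kc : K c by apply/(argmaxP um umE).
have rho : inradius Omega = a / 3.
  apply/eqP; rewrite eq_le; apply/andP; split.
    by apply: ge_sup; [exists (bdist Omega c), c|move=> _ [x cx <-]; exact: dle].
  rewrite -(dK c Kc); apply: ub_le_sup; last by exists c.
  by exists (a / 3) => _ [x cx <-]; exact: dle.
have ridge : high_ridge Omega = K.
  apply/seteqP; split=> x; last first.
    by move=> Kx; split; [exact: KO|rewrite rho dK].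
  move=> [Ox]; rewrite rho => dx; apply: contrapT => nKx.
  have Wx : (Omega `\` K) x by [].
  by move: dx; rewrite dW //; have := gap_gt0 um umE Wx; lra.
rewrite ridge; apply/seteqP; split.
  have clK : closed K.
    have -> : K = closure Omega `&` u @^-1` [set t | t = m].
      by apply/seteqP; split => x /(argmaxP um umE).
    by apply: closed_within_preimage => //; exact: closed_closure.
  (* [K] is closed, so it suffices to place singular points in it: off [K] the distance is a smooth
     function of [u], because u < m keeps the fourth root away from 0. *)
  rewrite [X in _ `<=` X](proj1 (closure_id K) clK); apply: closureS => x [Ox nd].
  apply: contrapT => nKx; apply: nd; have Wx : (Omega `\` K) x by [].
  have oW := open_off_argmax oO cu um umE.
  have [C1 _] := C11; have [du _] := C1 x Wx.
  apply: (@near_eq_differentiable _ _ _ (3^-1 *: (cst a - gap u m))); last first.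
    have near := open_nbhs_nbhs (conj oW Wx).
    by apply: filterS near => y Wy; rewrite dW // mulrC.
  have [_ xm] := (off_argmaxP um umE x).1 Wx.
  apply: differentiableZ; apply: differentiableB; first exact: differentiable_cst.
  have dg : differentiable (4 *: (cst m - u)) x.
    by apply: differentiableZ; apply: differentiableB => //; exact: differentiable_cst.
  apply: (@differentiable_comp _ _ _ _ (fun y => 4 * (m - u y))
    (fun t => qroot t ^+ 3)); first exact: dg.
  have m4 : 0 < 4 * (m - u x) by rewrite mulr_gt0 // subr_gt0.
  exact: (differentiable_comp (differentiable_qroot m4) (differentiable_cube _)).
(* On [K] the distance attains its maximum, and is therefore singular there. *)
apply: subset_trans (@subset_closure _ _) => x Kx.
apply: bdist_max_singular => //; first exact: KO.
by move=> y Oy; rewrite (dK x Kx); exact/dle/subset_closure.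
Qed.

End CutLocus.

Unset Implicit Arguments.
Set Strict Implicit.

Theorem proposition26 (R : realType) (n : nat) (Omega : set 'rV[R]_n)
    (u : 'rV[R]_n -> R) (delta : R) :
  Omega !=set0 -> open Omega -> bounded_set Omega ->
  convex_set (Omega : set (convex_lmodType 'rV[R]_n)) ->
  interior_sphere Omega ->
  cut_locus Omega <> high_ridge Omega ->
  antipodal_inner_ball Omega ->
  dirichlet_solution Omega u ->
  0 < delta ->
  C1_upto_boundary Omega
    [set x | closure Omega x /\ bdist Omega x < delta] u ->
  ~ C11_on (Omega `\` argmax_set Omega u) u.
Proof.
(* The contact point [p] makes the boundary nonempty, so [bdist] is a genuine infimum and not the
   default value 0. *)
move=> O0 oO bO _ _ neq [c [_ [p [q [[_ dp] _ _ _]]]]] sol _ _ C11.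
by apply: neq; apply: C11_cut_locus C11 => //; exists p.
Qed.
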